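(* The Lie algebra $\mathbf g=\mathfrak{su}_3(\mathbb C,1)$ is reductive with a $4$-dimensional subalgebra $\mathbf h$ and a complementary subspace $\mathbf m$ generating $\mathbf g$ if and only if, up to conjugation, one of the following holds: 1) $\mathbf h=\mathbf h_1=\langle e_1,e_2,e_3,e_6\rangle\cong\mathfrak{so}_3(\mathbb R)\oplus\mathfrak{so}_2(\mathbb R)$ and $\mathbf m=\mathbf m_1=\langle e_4,e_5,e_7,e_8\rangle$; 2) $\mathbf h=\mathbf h_4=\langle e_1,e_6,e_7,e_8\rangle\cong\mathfrak{sl}_2(\mathbb R)\oplus\mathfrak{so}_2(\mathbb R)$ and $\mathbf m=\mathbf m_4=\langle e_2,e_3,e_4,e_5\rangle$.
   Context: $\mathbf g=\mathfrak{su}_3(\mathbb C,1)$ is the real Lie algebra of matrices with basis $e_1,\dots,e_8$ determined by $$\sum_{j=1}^8\lambda_j e_j=\begin{pmatrix}-\lambda_1 i&-\lambda_2-\lambda_3 i&\lambda_4+\lambda_5 i\\ \lambda_2-\lambda_3 i&\lambda_1 i+\lambda_6 i&\lambda_7+\lambda_8 i\\ \lambda_4-\lambda_5 i&\lambda_7-\lambda_8 i&-\lambda_6 i\end{pmatrix},\qquad\lambda_j\in\mathbb R,\ i^2=-1.$$ $\langle\cdots\rangle$ denotes the real linear span. $\mathbf g$ is reductive with $\mathbf h$ and $\mathbf m$ if $\mathbf h$ is a subalgebra, $\mathbf m$ is a subspace, $\mathbf g=\mathbf m\oplus\mathbf h$ and $[\mathbf h,\mathbf m]\subseteq\mathbf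 m$. ''$\mathbf m$ generates $\mathbf g$'' means generation as a Lie algebra. ''Up to conjugation'' means that the pair $(\mathbf h,\mathbf m)$ may be replaced by its image under $Ad_g$, $g\in PSU_3(\mathbb C,1)$. *)

(* Defs.v *)
From HB Require Import structures.
From mathcomp Require Import all_boot all_order all_algebra.
From mathcomp Require Import ring lra complex reals.

Set Implicit Arguments.
Unset Strict Implicit.
Unset Printing Implicit Defensive.

Import GRing.Theory Num.Theory.
Local Open Scope ring_scope.

HB.mixin Record Vector_isLieAlgebra (F : fieldType) V of Vector F V := {
  lie : V -> V -> V;
  lie_linearl : forall y, linear (lie^~ y);
  lie_linearr : forall x, linear (lie x);
  lie_alt : forall x, lie x x = 0;
  lie_jacobi : forall x y z,
    lie x (lie y z) + lie y (lie z x) + lie z (lie x y) = 0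
}.

#[short(type="lieAlgType")]
HB.structure Definition LieAlgebra (F : fieldType) :=
  {V of Vector_isLieAlgebra F V & Vector F V}.

Section LieTheory.
Variables (F : fieldType) (L : lieAlgType F).
Implicit Types U h m : {vspace L}.

Definition is_subalgebra U := forall x y, x \in U -> y \in U -> lie x y \in U.

Definition generates_lie m :=
  forall U, is_subalgebra U -> (m <= U)%VS -> U = fullv.

Definition reductive_with h m :=
  [/\ is_subalgebra h,
      (m + h)%VS = fullv,
      (m :&: h)%VS = 0%VS
    & forall x y, x \in h -> y \in m -> lie x y \in m].

End LieTheory.

Definition lie_isom (F : fieldType) (L1 L2 : lieAlgType F)
    (U : {vspace L1}) (V : {vspace L2}) :=
  exists f : 'Hom(L1, L2),
    [/\ (f @: U)%VS = V,
        {in U &, injective f}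
      & {in U &, forall x y, f (lie x y) = lie (f x) (f y)}].

Section Commutator.
Variables (F : fieldType) (n : nat).
Implicit Types A B : 'M[F]_n.

Definition commmx A B := A *m B - B *m A.

Lemma commmx_linearl B : linear (commmx^~ B).
Proof.
move=> a A A'; rewrite /commmx mulmxDl mulmxDr -scalemxAl -scalemxAr scalerBr.
by rewrite opprD addrACA.
Qed.

Lemma commmx_linearr A : linear (commmx A).
Proof.
move=> a B B'; rewrite /commmx mulmxDl mulmxDr -scalemxAl -scalemxAr scalerBr.
by rewrite opprD addrACA.
Qed.

Lemma commmx_alt A : commmx A A = 0.
Proof. by rewrite /commmx subrr. Qed.

Lemma commmx_jacobi A B C :
  commmx A (commmx B C) + commmx B (commmx C A) + commmx C (commmx A B) = 0.
Proof.
rewrite /commmx !(mulmxBl, mulmxBr) !mulmxA.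
set a := A *m B *m C; set b := A *m C *m B; set c := B *m C *m A.
set d := C *m B *m A; set e := B *m A *m C; set f := C *m A *m B.
rewrite !opprB -!addrA; apply/matrixP=> i j; rewrite !mxE.
by ring.
Qed.
End Commutator.

HB.instance Definition _ (F : fieldType) (n : nat) :=
  Vector_isLieAlgebra.Build F 'M[F]_n (@commmx_linearl F n)
    (@commmx_linearr F n) (@commmx_alt F n) (@commmx_jacobi F n).

Section DirectSum.
Variables (F : fieldType) (L1 L2 : lieAlgType F).
Implicit Types x y z : L1 * L2.

Definition lie_pair x y : L1 * L2 := (lie x.1 y.1, lie x.2 y.2).

Lemma lie_pair_linearl y : linear (lie_pair^~ y).
Proof. by move=> a x x'; congr pair; apply: lie_linearl. Qed.

Lemma lie_pair_linearr x : linear (lie_pair x).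
Proof. by move=> a y y'; congr pair; apply: lie_linearr. Qed.

Lemma lie_pair_alt x : lie_pair x x = 0.
Proof. by congr pair; apply: lie_alt. Qed.

Lemma lie_pair_jacobi x y z :
  lie_pair x (lie_pair y z) + lie_pair y (lie_pair z x)
    + lie_pair z (lie_pair x y) = 0.
Proof. by congr pair; apply: lie_jacobi. Qed.

HB.instance Definition _ :=
  Vector_isLieAlgebra.Build F (L1 * L2)%type lie_pair_linearl
    lie_pair_linearr lie_pair_alt lie_pair_jacobi.

Definition dsumv (U : {vspace L1}) (V : {vspace L2}) : {vspace L1 * L2} :=
  (linfun (@fst L1 L2) @^-1: U :&: linfun (@snd L1 L2) @^-1: V)%VS.

Lemma mem_dsumv U V x : (x \in dsumv U V) = (x.1 \in U) && (x.2 \in V).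
Proof. by rewrite memv_cap -!memv_preim !lfunE. Qed.
End DirectSum.

Section Classical.
Variables (F : fieldType) (n : nat).

Definition so_alg : {vspace 'M[F]_n} := lker (linfun trmx + \1)%VF.

Lemma mem_so (A : 'M[F]_n) : (A \in so_alg) = (A^T == - A).
Proof. by rewrite memv_ker add_lfunE id_lfunE lfunE addr_eq0. Qed.

Definition sl_alg : {vspace 'M[F]_n} :=
  lker (linfun (mxtrace : 'M[F]_n -> F^o)).

Lemma mem_sl (A : 'M[F]_n) : (A \in sl_alg) = (\tr A == 0).
Proof. by rewrite memv_ker lfunE. Qed.
End Classical.

(* An element of su_3(C,1) is represented by its real coordinates
   (lambda_1, ..., lambda_8); su21_mx gives the matrix itself. *)
Definition su21 (R : realType) : Type := 'rV[R]_8.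
HB.instance Definition _ (R : realType) := Vector.on (su21 R).

Section SU21.
Variable R : realType.
Local Notation C := R[i].
Local Open Scope complex_scope.
Implicit Types (x y z : su21 R) (X Y g : 'M[C]_3).

(* Coordinates and basis vectors are numbered from 1 to 8, hence the j.-1. *)
Definition lam x (j : nat) : R := (x : 'rV[R]_8) 0 (inord j.-1).

Definition e_ (j : nat) : su21 R := delta_mx 0 (inord j.-1) : 'rV[R]_8.

Definition su21_mx x : 'M[C]_3 :=
  let l := lam x in
  \matrix_(i, j) nth 0 (nth [::]
    [:: [:: 0 +i* - l 1;    - l 2 +i* - l 3;    l 4 +i* l 5];
        [:: l 2 +i* - l 3;  0 +i* (l 1 + l 6);  l 7 +i* l 8];
        [:: l 4 +i* - l 5;  l 7 +i* - l 8;      0 +i* - l 6]] i) j.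

(* Inverse of su21_mx on its range; not meaningful outside in_su21. *)
Definition su21_of_mx X : su21 R :=
  \row_(k < 8) nth 0
    [:: - complex.Im (X 0 0); complex.Re (X 1 0); - complex.Im (X 1 0);
        complex.Re (X 0 2%R); complex.Im (X 0 2%R); - complex.Im (X 2%R 2%R);
        complex.Re (X 1 2%R); complex.Im (X 1 2%R)] k.

Definition conjT X : 'M[C]_3 := (map_mx (@conjc R) X)^T.

(* The Hermitian form preserved by the matrices su21_mx x. *)
Definition J21 : 'M[C]_3 := diag_mx (\row_j (-1) ^+ (j == 2%R :> 'I_3)).

Definition in_su21 X := conjT X *m J21 + J21 *m X = 0 /\ \tr X = 0.

Lemma lamP x y : (forall j, (0 < j < 9)%N -> lam x j = lam y j) -> x = y.
Proof.
move=> e; apply/rowP=> k; have := e k.+1; rewrite /lam /= inord_val ltnS.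
by apply; apply: ltn_ord.
Qed.

Lemma su21_basis x : x = \sum_(1 <= j < 9) lam x j *: e_ j.
Proof.
apply/rowP=> k; rewrite big_add1 /= big_mkord summxE (bigD1 k) //=.
rewrite /lam /e_ !mxE /= inord_val !eqxx mulr1 big1 ?addr0 // => i ik.
by rewrite !mxE /= inord_val eq_sym (negPf ik) mulr0.
Qed.

Lemma su21_mxK : cancel su21_mx su21_of_mx.
Proof.
move=> x; apply: lamP => -[//|j] /andP[_]; rewrite ltnS => jP.
rewrite {1}/lam mxE inordK // !mxE.
by move: j jP; do 8?[case=> /= [_|]]; rewrite ?opprK.
Qed.

Lemma su21_mx_linear (a : R) x y :
  su21_mx (a *: x + y) = a%:C *: su21_mx x + su21_mx y.
Proof.
apply/matrixP=> -[[|[|[|//]]] ?] -[[|[|[|//]]] ?]; rewrite !mxE /lam !mxE /=;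
  by apply/eqP; rewrite eq_complex /=; apply/andP; split; apply/eqP; ring.
Qed.

Lemma su21_mxD x y : su21_mx (x + y) = su21_mx x + su21_mx y.
Proof. by rewrite -[x]scale1r su21_mx_linear rmorph1 !scale1r. Qed.

Lemma su21_mx0 : su21_mx 0 = 0.
Proof. by apply: (addrI (su21_mx 0)); rewrite -su21_mxD !addr0. Qed.

Lemma su21_of_mx_linear (a : R) X Y :
  su21_of_mx (a%:C *: X + Y) = a *: su21_of_mx X + su21_of_mx Y.
Proof.
have ReZ (u v : C) : complex.Re (a%:C * u + v)
    = a * complex.Re u + complex.Re v.
  by case: u v => [? ?] [? ?] /=; rewrite mul0r subr0.
have ImZ (u v : C) : complex.Im (a%:C * u + v)
    = a * complex.Im u + complex.Im v.
  by case: u v => [? ?] [? ?] /=; rewrite mul0r addr0.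
apply/rowP=> -[k kP]; rewrite !mxE /=; rewrite !ReZ !ImZ.
by move: k kP; do 8?[case=> /= [_|]] => //; ring.
Qed.

Lemma su21_mx_in x : in_su21 (su21_mx x).
Proof.
split.
  apply/matrixP=> -[[|[|[|//]]] ?] -[[|[|[|//]]] ?];
  rewrite !mxE !big_ord_recl !big_ord0 !mxE /= ?mulr1n ?mulr0n ?expr0 ?expr1;
  by apply/eqP; rewrite eq_complex /=; apply/andP; split; apply/eqP; ring.
rewrite /mxtrace !big_ord_recl big_ord0 !mxE /=.
by apply/eqP; rewrite eq_complex /=; apply/andP; split; apply/eqP; ring.
Qed.

Lemma su21_of_mxK X : in_su21 X -> su21_mx (su21_of_mx X) = X.
Proof.
case=> XJ trX.
pose d (i : 'I_3) : C := (-1) ^+ (i == 2%R :> 'I_3).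
have E i j : (X j i)^* * d j + d i * X i j = 0.
  move/matrixP/(_ i j): XJ; rewrite /J21 mul_mx_diag mul_diag_mx !mxE.
  by rewrite /d.
have I3 (i : 'I_3) : [\/ i = 0, i = 1 | i = 2%R].
  by case: i => -[|[|[|//]]] p; [constructor 1|constructor 2|constructor 3];
    apply: val_inj.
have tr : X 0 0 + X 1 1 + X 2%R 2%R = 0.
  rewrite -trX /mxtrace !big_ord_recl big_ord0 addr0 addrA.
  by congr (X _ _ + X _ _ + X _ _); apply: val_inj.
move: (E 0 0) (E 1 1) (E 2%R 2%R) (E 1 0) (E 2%R 0) (E 2%R 1) tr.
rewrite /d /= !expr0 !expr1 => {E}.
move=> E00 E11 E22 E10 E20 E21 tr.
apply/matrixP=> i j; rewrite !mxE.
have lE k : (0 < k < 9)%N -> lam (su21_of_mx X) k = nth 0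
    [:: - complex.Im (X 0 0); complex.Re (X 1 0); - complex.Im (X 1 0);
        complex.Re (X 0 2%R); complex.Im (X 0 2%R); - complex.Im (X 2%R 2%R);
        complex.Re (X 1 2%R); complex.Im (X 1 2%R)] k.-1.
  by case: k => [//|k] /andP[_ kP]; rewrite /lam mxE inordK.
rewrite !lE //= => {lE}.
have cE (u v : C) : u = v ->
    complex.Re u = complex.Re v /\ complex.Im u = complex.Im v by move=> ->.
case: (I3 i) => ->; case: (I3 j) => -> /=; move: E00 E11 E22 E10 E20 E21 tr;
move: (X 0 0) (X 0 1) (X 0 2%R) (X 1 0) (X 1 1) (X 1 2%R)
  (X 2%R 0) (X 2%R 1) (X 2%R 2%R);
do 9![case=> ? ?]; do 7![move=> /cE /= [? ?]];
by apply/eqP; rewrite eq_complex /=; apply/andP; split; apply/eqP; lra.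
Qed.

Lemma su21_mxP X : in_su21 X <-> exists x, su21_mx x = X.
Proof.
split=> [XP|[x <-]]; last exact: su21_mx_in.
by exists (su21_of_mx X); apply: su21_of_mxK.
Qed.

Lemma commmx_su21 X Y : in_su21 X -> in_su21 Y -> in_su21 (commmx X Y).
Proof.
have cM A B : conjT (A *m B) = conjT B *m conjT A.
  by rewrite /conjT map_mxM trmx_mul.
case=> XJ _ [YJ _]; split; last first.
  by rewrite /commmx raddfB /= mxtrace_mulC subrr.
have {}XJ : conjT X *m J21 = - (J21 *m X) by apply/eqP; rewrite -addr_eq0 XJ.
have {}YJ : conjT Y *m J21 = - (J21 *m Y) by apply/eqP; rewrite -addr_eq0 YJ.
have -> : conjT (commmx X Y) = conjT Y *m conjT X - conjT X *m conjT Y.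
  by rewrite -!cM /conjT map_mxB raddfB.
rewrite mulmxBl -!mulmxA XJ YJ !mulmxN !mulmxA XJ YJ !mulNmx !opprK.
by rewrite /commmx mulmxBr !mulmxA addrC addrA subrK subrr.
Qed.

(* The commutator stays in the range of su21_mx, see su21_mx_lie. *)
Definition lie_su21 x y := su21_of_mx (commmx (su21_mx x) (su21_mx y)).

Lemma su21_mx_lie x y :
  su21_mx (lie_su21 x y) = commmx (su21_mx x) (su21_mx y).
Proof. by rewrite su21_of_mxK //; apply: commmx_su21; apply: su21_mx_in. Qed.

Lemma lie_su21_linearl y : linear (lie_su21^~ y).
Proof.
move=> a x x'.
by rewrite /lie_su21 su21_mx_linear commmx_linearl su21_of_mx_linear.
Qed.

Lemma lie_su21_linearr x : linear (lie_su21 x).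
Proof.
move=> a y y'.
by rewrite /lie_su21 su21_mx_linear commmx_linearr su21_of_mx_linear.
Qed.

Lemma lie_su21_alt x : lie_su21 x x = 0.
Proof. by rewrite /lie_su21 commmx_alt -su21_mx0 su21_mxK. Qed.

Lemma lie_su21_jacobi x y z :
  lie_su21 x (lie_su21 y z) + lie_su21 y (lie_su21 z x)
    + lie_su21 z (lie_su21 x y) = 0.
Proof.
apply: (can_inj su21_mxK); rewrite su21_mx0.
rewrite -(commmx_jacobi (su21_mx x) (su21_mx y) (su21_mx z)) -!su21_mx_lie.
by rewrite -!su21_mxD.
Qed.

HB.instance Definition _ :=
  Vector_isLieAlgebra.Build R (su21 R) lie_su21_linearl
    lie_su21_linearr lie_su21_alt lie_su21_jacobi.

(* SU_3(C,1), the isometry group of J21 with determinant 1.  PSU_3(C,1) is its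
   quotient by the scalar matrices it contains; these act trivially by
   conjugation, so Ad of a class is given by any representative. *)
Definition is_SU21 g := conjT g *m J21 *m g = J21 /\ \det g = 1.

Definition Ad g x : su21 R := su21_of_mx (g *m su21_mx x *m invmx g).

Lemma Ad_linear g : linear (Ad g).
Proof.
move=> a x y; rewrite /Ad su21_mx_linear mulmxDr mulmxDl.
by rewrite -scalemxAr -scalemxAl su21_of_mx_linear.
Qed.

HB.instance Definition _ g :=
  GRing.isLinear.Build R (su21 R) (su21 R) *:%R (Ad g) (Ad_linear g).

Lemma su21_mx_Ad g x :
  is_SU21 g -> su21_mx (Ad g x) = g *m su21_mx x *m invmx g.
Proof.
case=> gJ dg; rewrite su21_of_mxK //.
have cM A B : conjT (A *m B) = conjT B *m conjT A.
  by rewrite /conjT map_mxM trmx_mul.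
have gu : g \in unitmx by rewrite unitmxE dg unitr1.
have cgu : conjT g \in unitmx.
  by rewrite /conjT unitmx_tr map_unitmx.
have gV : conjT (invmx g) = invmx (conjT g).
  by rewrite /conjT map_invmx trmx_inv.
have [XJ tX] := su21_mx_in x; split; last by rewrite mxtrace_mulC mulKmx.
have Jg : J21 *m g = invmx (conjT g) *m J21 by rewrite -[in RHS]gJ -mulmxA mulKmx.
have gJ' : J21 *m invmx g = conjT g *m J21 by rewrite -[in LHS]gJ mulmxK.
rewrite !cM gV -!mulmxA -gJ' [J21 *m (g *m _)]mulmxA Jg -!mulmxA -mulmxDr.
by rewrite ![in X in _ *m X]mulmxA -mulmxDl XJ mul0mx mulmx0.
Qed.

Definition AdV g (U : {vspace su21 R}) : {vspace su21 R} :=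
  (linfun (Ad g) @: U)%VS.

Definition h1 : {vspace su21 R} := <<[:: e_ 1; e_ 2; e_ 3; e_ 6]>>%VS.
Definition m1 : {vspace su21 R} := <<[:: e_ 4; e_ 5; e_ 7; e_ 8]>>%VS.
Definition h4 : {vspace su21 R} := <<[:: e_ 1; e_ 6; e_ 7; e_ 8]>>%VS.
Definition m4 : {vspace su21 R} := <<[:: e_ 2; e_ 3; e_ 4; e_ 5]>>%VS.
End SU21.

(* Main.v *)
From HB Require Import structures.
Require Import Defs.
From mathcomp Require Import all_boot all_order all_algebra.
From mathcomp Require Import ring lra complex reals.

Set Implicit Arguments.
Unset Strict Implicit.
Unset Printing Implicit Defensive.

Import Order.TTheory GRing.Theory Num.Theory.
Local Open Scope ring_scope.

(** Let h be a subalgebra of dimension 4 with an invariant complement m.  The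
   matrices of h act on row vectors of C^3 from the right, and the point is
   that they stabilise a line C u which is not isotropic for the Hermitian form
   J.  Once this is known, SU(2,1) moves u to the first basis vector or to the
   third one, according to the sign of u J u^*; the stabilisers of these two
   vectors are h4 and h1, which have dimension 4, so h becomes one of them.
   Both contain a central element whose centraliser is the subalgebra itself,
   and this forces the complement (complement_unique).

   To find the line, let B(x, y) = tr(xy), an invariant nondegenerate real
   form.  The alternating form B([x, y], z) on the space h, of dimension 4, has
   a nonzero kernel vector c (alternating3_kernel): every x = [c, y] with y in
   h is orthogonal to h.  Such an x vanishes (commutator_orthogonal).  Indeed
   tr x = tr x^2 = 0 gives x^3 = d, and then (ad x)^5 = -9 d ad(x^2) turns
   B((ad x)^5 c, y) = 0 into d = 0.  So x is nilpotent and (ad x)^5 = 0; as h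
   and m are invariant of dimension 4, already (ad x)^4 = 0 on both, hence on
   the whole algebra, which forces x^2 = 0 (nilpotent_square).  Finally a
   square-zero x has rank at most 1 and (ad x)^2 y = -2 B(x, y) x, which lies
   in both m and h when y is in m; so x is orthogonal to m as well as to h
   (square_zero_orthogonal).

   Therefore c commutes with h.  If l is an eigenvalue of c, either the row
   space or the kernel of c - l is a line stabilised by h
   (central_stable_line).  If this line is isotropic, it can be moved to the
   line of (1, 0, 1).  Its stabiliser is a parabolic subalgebra of dimension 5,
   whose nilradical is a Heisenberg algebra, and h has to contain the centre of
   that nilradical (nilradical_center_mem).  This centre is spanned by a
   square-zero element orthogonal to h, which was excluded above. *)

(** * Linear algebra: nilpotent maps and alternating forms *)

Section LinearAlgebra.
Variables (F : fieldType) (V : vectType F).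

Lemma iter_linear0 (f : 'End(V)) n : iter n f 0 = 0.
Proof. by elim: n => // n IH; rewrite iterS IH linear0. Qed.

(** As long as U is nonzero, f U is a proper subspace of U, since f U = U would
   make every iterate of f onto U.  So the dimension drops at each step. *)
Lemma nilpotent_iter_dim (f : 'End(V)) (U : {vspace V}) n :
  (f @: U <= U)%VS -> {in U, forall u, iter n f u = 0} ->
  {in U, forall u, iter (\dim U) f u = 0}.
Proof.
elim: {U}(\dim U).+1 {-2}U (ltnSn (\dim U)) => // d IH U dU fU fn u uU.
have [U0|U0] := eqVneq U 0%VS.
  have -> : u = 0 by apply/eqP; rewrite -memv0 -U0.
  exact: iter_linear0.
have lt : (\dim (f @: U) < \dim U)%N.
  rewrite ltn_neqAle dimvS // andbT; apply/negP=> /eqP e.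
  have eU : (f @: U)%VS = U by apply/eqP; rewrite eqEdim fU e leqnn.
  have surj k w : w \in U -> exists2 v, v \in U & w = iter k f v.
    elim: k w => [|k IHk] w wU; first by exists w.
    have [v vU ->] := IHk w wU.
    move: vU; rewrite -{1}eU => /memv_imgP[v' v'U ->].
    by exists v'; rewrite // iterSr.
  have [v vU] := surj n _ (memv_pick U).
  by rewrite fn // => /eqP; rewrite vpick0 (negPf U0).
have fnf : {in (f @: U)%VS, forall u, iter n f u = 0}.
  by move=> w /(subvP fU); apply: fn.
have := IH _ (leq_trans lt dU) (limgS f fU) fnf (f u) (memv_img _ uU).
by rewrite -iterSr -(subnK lt) iterD => ->; apply: iter_linear0.
Qed.

(** A trilinear alternating form on a space of dimension 4 is the contraction
   of a volume form with a vector, so that vector lies in its kernel; the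
   coordinates of the vector are the signed values of the form on the triples
   of basis vectors. *)
Lemma alternating3_kernel (w : V -> V -> V -> F) (U : {vspace V}) :
  (forall a x x' y z, w (a *: x + x') y z = a * w x y z + w x' y z) ->
  (forall x y z, w y x z = - w x y z) ->
  (forall x y z, w x z y = - w x y z) ->
  (forall x z, w x x z = 0) ->
  \dim U = 4%N ->
  exists c, [/\ c \in U, c != 0 & {in U &, forall y z, w c y z = 0}].
Proof.
move=> wl w12 w23 wa dU.
have wb x z : w x z z = 0 by rewrite -[LHS]opprK -w12 -w23 wa.
have w0 y z : w 0 y z = 0.
  by have := wl (-1) 0 0 y z; rewrite scaler0 addr0 mulN1r addNr.
have wZ a x y z : w (a *: x) y z = a * w x y z.
  by have := wl a x 0 y z; rewrite addr0 w0 addr0.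
have wD x x' y z : w (x + x') y z = w x y z + w x' y z.
  by have := wl 1 x x' y z; rewrite scale1r mul1r.
have [b [fb bU sb]] : exists b : 4.-tuple V,
    [/\ free b, {subset b <= U} & (U <= <<b>>)%VS].
  move: (vbasis U) (vbasisP U); rewrite dU => b bP; exists b.
  by rewrite (basis_free bP) (span_basis bP) subvv; split=> // v; apply: basis_mem.
pose c := w b`_1 b`_2 b`_3 *: b`_0 - w b`_0 b`_2 b`_3 *: b`_1
  + w b`_0 b`_1 b`_3 *: b`_2 - w b`_0 b`_1 b`_2 *: b`_3.
have lin y : y \in U -> y = \sum_(i < 4) coord b i y *: b`_i.
  by move=> yU; apply: coord_span; apply: (subvP sb).
have wsum y z (a : 'I_4 -> F) :
    w (\sum_i a i *: b`_i) y z = \sum_i a i * w b`_i y z.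
  rewrite (big_morph (fun x => w x y z) (id1 := 0) (op1 := +%R)) //.
  by apply: eq_bigr => i _.
have kerP u : (forall i j : 'I_4, w u b`_i b`_j = 0) ->
    {in U &, forall y z, w u y z = 0}.
  move=> ub y z /lin-> /lin->.
  rewrite -[LHS]opprK -w12 wsum big1 ?oppr0 // => i _.
  rewrite w12 -[w _ _ _]opprK -w23 -w12 wsum big1 ?oppr0 ?mulr0 // => j _.
  by rewrite w12 w23 opprK ub mulr0.
pose s12 (i j : nat) := w12 b`_i b`_j; pose s23 i j x := w23 x b`_i b`_j.
have S := (s12 0 1, s12 0 2, s12 0 3, s12 1 2, s12 1 3, s12 2 3,
  s23 0 1, s23 0 2, s23 0 3, s23 1 2, s23 1 3, s23 2 3)%N.
have b0 : b`_0 \in b by apply: mem_nth; rewrite size_tuple.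
(* If c vanishes, then so do all values of w on triples of basis vectors, and
   any basis vector will do. *)
have [c0|cn0] := eqVneq c 0; last first.
  exists c; split=> //; last first.
    apply: kerP => i j; rewrite /c -!scaleNr !(wD, wZ).
    case: i => -[|[|[|[|//]]]] ? /=; case: j => -[|[|[|[|//]]]] ? /=;
      rewrite ?S ?wa ?wb; ring.
  have bUn i : (i < 4)%N -> b`_i \in U.
    by move=> i4; apply/bU/mem_nth; rewrite size_tuple.
  by rewrite /c !(rpredD, rpredN, rpredZ, bUn).
exists b`_0; split; [exact: bU | exact: free_not0 fb b0 |].
pose k (i : 'I_4) := [:: w b`_1 b`_2 b`_3; - w b`_0 b`_2 b`_3;
  w b`_0 b`_1 b`_3; - w b`_0 b`_1 b`_2]`_i.
have k0 : forall i, k i = 0.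
  have /freeP := fb; apply; rewrite !big_ord_recl big_ord0 /k /= addr0 !scaleNr.
  by rewrite -[RHS]c0 /c !addrA.
have := (k0 1, k0 2%R, k0 3%R); rewrite /k /= => -[[/eqP + k2] /eqP].
rewrite !oppr_eq0 => /eqP k1 /eqP k3.
apply: kerP; case=> -[|[|[|[|//]]]] ? /=; case=> -[|[|[|[|//]]]] ? /=;
  by rewrite ?S ?wa ?wb ?k1 ?k2 ?k3 ?oppr0.
Qed.
End LinearAlgebra.

(** * Images of reductive pairs and coordinates on su(2,1) *)

Section LieBasics.
Variables (F : fieldType) (L : lieAlgType F).

HB.instance Definition _ (x : L) :=
  GRing.isLinear.Build F L L *:%R (lie x) (lie_linearr x).

Lemma lieC (x y : L) : lie y x = - lie x y.
Proof.
have lieDl (a b c : L) : lie (a + b) c = lie a c + lie b c.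
  by have := lie_linearl c 1 a b; rewrite !scale1r.
apply/eqP; rewrite -addr_eq0 addrC; have := lie_alt (x + y).
by rewrite lieDl !linearD /= !lie_alt add0r addr0 => ->.
Qed.

Variables (f : 'End(L)).
Hypotheses (f_inj : lker f == 0%VS) (f_lie : {morph f : x y / lie x y}).

Let f_full : (f @: fullv)%VS = fullv.
Proof.
apply/eqP; rewrite eqEdim subvf; rewrite limg_dim_eq ?leqnn //.
by rewrite (eqP f_inj) capv0. Qed.

(** This lemma and the next one transport the structure along a Lie algebra
   automorphism; they are used for the maps Ad g. *)
Lemma reductive_with_img (h m : {vspace L}) :
  reductive_with h m -> reductive_with (f @: h) (f @: m).
Proof.
case=> hh mh mh0 hm; split.
- move=> _ _ /memv_imgP[x xh ->] /memv_imgP[y yh ->].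
  by rewrite -f_lie memv_img // hh.
- by rewrite -limgD mh f_full.
- apply/eqP; rewrite -subv0; apply/subvP=> v /memv_capP[].
  move=> /memv_imgP[x xm ->] /memv_imgP[y yh e].
  have xy : x = y by move/lker0P: f_inj; apply.
  have /eqP-> : x == 0 by rewrite -memv0 -mh0 memv_cap xm xy.
  by rewrite linear0 mem0v.
by move=> _ _ /memv_imgP[x xh ->] /memv_imgP[y yh ->];
  rewrite -f_lie memv_img // hm.
Qed.

Lemma generates_lie_img (m : {vspace L}) :
  generates_lie m -> generates_lie (f @: m)%VS.
Proof.
move=> gm U Usub mU.
suff W : (f @^-1: U)%VS = fullv.
  apply/eqP; rewrite eqEsubv subvf /=.
  by rewrite -f_full -W lpreimK ?subvv // f_full subvf.
apply: gm.
  by move=> x y; rewrite -!memv_preim f_lie => ? ?; apply: Usub.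
by apply/subvP=> x xm; rewrite -memv_preim; apply: (subvP mU); apply: memv_img.
Qed.

End LieBasics.

Section Coordinates.
Variable R : realType.
Local Notation C := R[i].
Local Open Scope complex_scope.
Implicit Types x y : su21 R.

Definition mx3 (a b c d e f p q r : C) : 'M[C]_3 :=
  \matrix_(k, l) nth 0 (nth [::] [:: [:: a; b; c]; [:: d; e; f]; [:: p; q; r]] k) l.

Lemma su21_mxE x : su21_mx x = mx3
  (0 +i* - lam x 1) (- lam x 2 +i* - lam x 3) (lam x 4 +i* lam x 5)
  (lam x 2 +i* - lam x 3) (0 +i* (lam x 1 + lam x 6)) (lam x 7 +i* lam x 8)
  (lam x 4 +i* - lam x 5) (lam x 7 +i* - lam x 8) (0 +i* - lam x 6).
Proof. by apply/matrixP=> i j; rewrite !mxE. Qed.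

Lemma lam_linear (a : R) x y j : lam (a *: x + y) j = a * lam x j + lam y j.
Proof. by rewrite /lam !mxE. Qed.

Lemma lamD x y j : lam (x + y) j = lam x j + lam y j.
Proof. by rewrite /lam !mxE. Qed.

Lemma lamN x j : lam (- x) j = - lam x j.
Proof. by rewrite /lam !mxE. Qed.

Lemma lamZ (a : R) x j : lam (a *: x) j = a * lam x j.
Proof. by rewrite /lam !mxE. Qed.

Lemma lam0 j : lam (0 : su21 R) j = 0.
Proof. by rewrite /lam !mxE. Qed.

Lemma lam_e i j : (0 < i < 9)%N -> (0 < j < 9)%N ->
  lam (e_ R i) j = (i == j)%:R.
Proof.
case: i j => [|i] [|j] //= i8 j8.
by rewrite /lam mxE eqxx -val_eqE /= !inordK // eqSS eq_sym.
Qed.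

Lemma lam_matrix (x : su21 R) j : (0 < j < 9)%N -> lam x j = nth 0
    [:: - complex.Im (su21_mx x 0 0); complex.Re (su21_mx x 1 0);
        - complex.Im (su21_mx x 1 0); complex.Re (su21_mx x 0 2%R);
        complex.Im (su21_mx x 0 2%R); - complex.Im (su21_mx x 2%R 2%R);
        complex.Re (su21_mx x 1 2%R); complex.Im (su21_mx x 1 2%R)] j.-1.
Proof.
case: j => [//|j] /andP[_ jP]; rewrite -{1}[x]su21_mxK /lam mxE inordK //.
Qed.

(** The 2 x 2 minors of the coordinates, in which the structure constants of
   the bracket are short. *)
Definition plucker x y (p q : nat) := lam x p * lam y q - lam x q * lam y p.

Section Bracket.
Variables x y : su21 R.
Local Notation b := (plucker x y).

Definition lie_coords : seq R :=
  [:: 2 * b 4 5 - 2 * b 2 3;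
        2 * b 1 3 - b 3 6 - b 4 7 - b 5 8;
        b 2 6 - 2 * b 1 2 + b 4 8 - b 5 7;
        b 1 5 - b 2 7 + b 3 8 + b 5 6;
        - b 1 4 - b 2 8 - b 3 7 - b 4 6;
        - 2 * b 4 5 - 2 * b 7 8;
        b 2 4 - b 1 8 + b 3 5 - 2 * b 6 8;
        b 1 7 + b 2 5 - b 3 4 + 2 * b 6 7].

Lemma lam_lie j : (0 < j < 9)%N -> lam (lie x y) j = nth 0 lie_coords j.-1.
Proof.
move=> jP; rewrite lam_matrix // [su21_mx (lie x y)]su21_mx_lie.
rewrite !su21_mxE !mxE !big_ord_recl !big_ord0 !mxE /=.
by case: j jP => [|[|[|[|[|[|[|[|[|]]]]]]]]] //= _;
  rewrite /lie_coords /plucker; ring.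
Qed.

Lemma eq_lie z : (forall j, (0 < j < 9)%N -> lam z j = nth 0 lie_coords j.-1) ->
  z = lie x y.
Proof. by move=> zE; apply: lamP => j j8; rewrite zE // lam_lie. Qed.

End Bracket.

(** All the standard subspaces are spanned by basis vectors, so membership in
   them is the vanishing of coordinates. *)
Lemma mem_span_e (s : seq nat) x : {subset s <= iota 1 8} ->
  (x \in <<[seq e_ R j | j <- s]>>%VS) =
  all (fun j => (j \in s) || (lam x j == 0)) (iota 1 8).
Proof.
move=> s8; apply/idP/allP => [|H].
  elim: s s8 x => [|i s IH] s8 x.
    by rewrite span_nil memv0 => /eqP-> j _; rewrite lam0 eqxx orbT.
  rewrite /= span_cons => /memv_addP[_ /vlineP[k ->]] [y /IH ys ->] j j8.
  rewrite lamD lamZ lam_e -?mem_iota //; last by apply: s8; rewrite mem_head.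
  rewrite inE eq_sym; case: eqP => //= _; rewrite mulr0 add0r; apply: ys => //.
  by move=> ? ?; apply: s8; rewrite inE orbC; apply/orP; left.
rewrite [x]su21_basis big_seq rpred_sum // => j; rewrite mem_index_iota => j8.
have /H/orP[js|/eqP->] : j \in iota 1 8 by rewrite mem_iota.
  by rewrite memvZ // memv_span // map_f.
by rewrite scale0r mem0v.
Qed.

Lemma dim_span_e (s : seq nat) : {subset s <= iota 1 8} -> uniq s ->
  \dim <<[seq e_ R j | j <- s]>>%VS = size s.
Proof.
move=> s8 us; rewrite -[RHS](size_map (e_ R)); apply/eqP.
change (free [seq e_ R j | j <- s]).
elim: s s8 us => [|i s IH] s8 /= => [_|/andP[ins us]]; first exact: nil_free.
have ss8 : {subset s <= iota 1 8} by move=> j js; rewrite s8 // inE js orbT.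
have i8 : i \in iota 1 8 by rewrite s8 ?mem_head.
rewrite free_cons IH // andbT mem_span_e //; apply/allP => /(_ i i8).
by rewrite (negPf ins) lam_e -?mem_iota // eqxx oner_eq0.
Qed.

End Coordinates.

(** * The two standard pairs *)

Section UniqueComplement.
Variables (F : fieldType) (L : lieAlgType F).
Implicit Types h m : {vspace L}.

Lemma reductive_dim h m : reductive_with h m ->
  (\dim m + \dim h)%N = \dim {: L}.
Proof. by case=> _ <- mh0 _; rewrite dimv_disjoint_sum. Qed.

(** As L = m' + h and c is central in h, ad c maps L into m'.  It also maps m
   into m, injectively because its kernel lies in h.  So m = [c, m] lies in m',
   and the dimensions agree. *)
Lemma complement_unique h m m' c : reductive_with h m -> reductive_with h m' ->
    c \in h -> {in h, forall x, lie c x = 0} ->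
    (forall x, lie c x = 0 -> x \in h) ->
  m = m'.
Proof.
move=> red red' ch ch0 chP; case: (red) (red') => _ _ mh0 hm [_ mh' _ hm'].
pose f := linfun (lie c).
have fm : (f @: m)%VS = m.
  apply/eqP; rewrite eqEdim limg_dim_eq ?leqnn ?andbT.
    by apply/subvP=> _ /memv_imgP[x xm ->]; rewrite lfunE hm.
  apply/eqP; rewrite -subv0 -mh0; apply/subvP=> x /memv_capP[xm].
  by rewrite memv_ker lfunE /= memv_cap xm => /eqP/chP.
have lefm : (m <= m')%VS.
  apply/subvP=> x; rewrite -fm => /memv_imgP[y _ ->]; rewrite lfunE /=.
  have : y \in (m' + h)%VS by rewrite mh' memvf.
  by case/memv_addP=> u um [v vh ->]; rewrite linearD /= (ch0 v) // addr0 hm'.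
apply/eqP; rewrite eqEdim lefm /= -(leq_add2r (\dim h)).
by rewrite (reductive_dim red) (reductive_dim red').
Qed.

End UniqueComplement.

Section StandardPairs.
Variable R : realType.
Implicit Types (x y : su21 R).

Lemma complementary_span_e (s t : seq nat) : perm_eq (t ++ s) (iota 1 8) ->
  (<<[seq e_ R j | j <- t]>> + <<[seq e_ R j | j <- s]>>)%VS = fullv /\
  (<<[seq e_ R j | j <- t]>> :&: <<[seq e_ R j | j <- s]>>)%VS = 0%VS.
Proof.
move=> st; have mst := perm_mem st.
have s8 : {subset s <= iota 1 8}.
  by move=> j js; rewrite -mst mem_cat js orbT.
have t8 : {subset t <= iota 1 8} by move=> j jt; rewrite -mst mem_cat jt.
split.
  apply/eqP; rewrite eqEsubv subvf -span_cat -map_cat; apply/subvP=> x _.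
  rewrite mem_span_e; last by move=> j; rewrite mst.
  by apply/allP=> j; rewrite mst => ->.
apply/eqP; rewrite -subv0; apply/subvP=> x /memv_capP[].
rewrite !mem_span_e // memv0 => /allP xt /allP xs.
apply/eqP/lamP => j; rewrite lam0 => jP.
have j8 : j \in iota 1 8 by rewrite mem_iota.
move: (xt j j8) (xs j j8); case: eqP => //; rewrite !orbF => _ jt js.
have: uniq (t ++ s) by rewrite (perm_uniq st) iota_uniq.
by rewrite cat_uniq => /and3P[_ /hasP[]]; exists j.
Qed.

Lemma mem_h1 x : (x \in h1 R) =
  [&& lam x 4 == 0, lam x 5 == 0, lam x 7 == 0 & lam x 8 == 0].
Proof.
apply: etrans (@mem_span_e R [:: 1; 2; 3; 6]%N x _) _; first exact/allP.
by rewrite /= andbT.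
Qed.

Lemma mem_m1 x : (x \in m1 R) =
  [&& lam x 1 == 0, lam x 2 == 0, lam x 3 == 0 & lam x 6 == 0].
Proof.
apply: etrans (@mem_span_e R [:: 4; 5; 7; 8]%N x _) _; first exact/allP.
by rewrite /= andbT.
Qed.

Lemma mem_h4 x : (x \in h4 R) =
  [&& lam x 2 == 0, lam x 3 == 0, lam x 4 == 0 & lam x 5 == 0].
Proof.
apply: etrans (@mem_span_e R [:: 1; 6; 7; 8]%N x _) _; first exact/allP.
by rewrite /= andbT.
Qed.

Lemma mem_m4 x : (x \in m4 R) =
  [&& lam x 1 == 0, lam x 6 == 0, lam x 7 == 0 & lam x 8 == 0].
Proof.
apply: etrans (@mem_span_e R [:: 2; 3; 4; 5]%N x _) _; first exact/allP.
by rewrite /= andbT.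
Qed.

Lemma dim_h1 : \dim (h1 R) = 4%N.
Proof. by apply: (@dim_span_e R [:: 1; 2; 3; 6]); first exact/allP. Qed.

Lemma dim_h4 : \dim (h4 R) = 4%N.
Proof. by apply: (@dim_span_e R [:: 1; 6; 7; 8]); first exact/allP. Qed.

Ltac lie_mem := rewrite ?(mem_h1, mem_m1, mem_h4, mem_m4) !lam_lie //
    /lie_coords /plucker /=;
  do 2![move=> /and4P[/eqP? /eqP? /eqP? /eqP?]]; apply/and4P;
  split; apply/eqP; nra.

Lemma reductive_h1 : reductive_with (h1 R) (m1 R).
Proof.
have [mh mh0] := @complementary_span_e [:: 1; 2; 3; 6] [:: 4; 5; 7; 8] isT.
by split=> // x y; lie_mem.
Qed.

Lemma reductive_h4 : reductive_with (h4 R) (m4 R).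
Proof.
have [mh mh0] := @complementary_span_e [:: 1; 6; 7; 8] [:: 2; 3; 4; 5] isT.
by split=> // x y; lie_mem.
Qed.

Ltac lie_basis := apply: eq_lie => -[|[|[|[|[|[|[|[|[|?]]]]]]]]] //= _;
  rewrite /plucker ?lamD ?lamN ?lamZ !lam_e //=; lra.

Lemma full_of_basis (U : {vspace su21 R}) :
  (forall j, (0 < j < 9)%N -> e_ R j \in U) -> U = fullv.
Proof.
move=> eU; apply/eqP; rewrite eqEsubv subvf; apply/subvP=> x _.
rewrite [x]su21_basis big_seq rpred_sum // => j; rewrite mem_index_iota => j8.
by rewrite memvZ // eU.
Qed.

Lemma memv_unscale (U : {vspace su21 R}) (a : R) x :
  a != 0 -> a *: x \in U -> x \in U.
Proof. by move=> a0; rewrite rpredZeq (negPf a0). Qed.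

(** The brackets of the elements of m1 already span h1. *)
Lemma generates_m1 : generates_lie (m1 R).
Proof.
move=> U Us mU; apply: full_of_basis.
have inU j : j \in [:: 4; 5; 7; 8]%N -> e_ R j \in U.
  by move=> js; apply/(subvP mU)/memv_span; have := map_f (e_ R) js.
have lieU i j : i \in [:: 4; 5; 7; 8]%N -> j \in [:: 4; 5; 7; 8]%N ->
  lie (e_ R i) (e_ R j) \in U by move=> ? ?; apply: Us; apply: inU.
have e2 : -1 *: e_ R 2 = lie (e_ R 4) (e_ R 7) by lie_basis.
have e3 : e_ R 3 = lie (e_ R 4) (e_ R 8) by lie_basis.
have e6 : - 2 *: e_ R 6 = lie (e_ R 7) (e_ R 8) by lie_basis.
have e1 : 2 *: e_ R 1 - 2 *: e_ R 6 = lie (e_ R 4) (e_ R 5) by lie_basis.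
have e6U : e_ R 6 \in U.
  by rewrite (@memv_unscale U (- 2)) ?e6 ?lieU ?oppr_eq0 ?pnatr_eq0.
have e1U : e_ R 1 \in U.
  rewrite (@memv_unscale U 2) ?pnatr_eq0 // -[_ *: _](subrK (2 *: e_ R 6)) e1.
  by rewrite memvD ?memvZ // lieU.
have e2U : e_ R 2 \in U.
  by rewrite (@memv_unscale U (-1)) ?e2 ?lieU ?oppr_eq0 ?oner_eq0.
have e3U : e_ R 3 \in U by rewrite e3 lieU.
by case=> [|[|[|[|[|[|[|[|[|j]]]]]]]]] // _; rewrite ?inU.
Qed.

(** The brackets of the elements of m4 already span h4. *)
Lemma generates_m4 : generates_lie (m4 R).
Proof.
move=> U Us mU; apply: full_of_basis.
have inU j : j \in [:: 2; 3; 4; 5]%N -> e_ R j \in U.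
  by move=> js; apply/(subvP mU)/memv_span; have := map_f (e_ R) js.
have lieU i j : i \in [:: 2; 3; 4; 5]%N -> j \in [:: 2; 3; 4; 5]%N ->
  lie (e_ R i) (e_ R j) \in U by move=> ? ?; apply: Us; apply: inU.
have e1 : - 2 *: e_ R 1 = lie (e_ R 2) (e_ R 3) by lie_basis.
have e6 : 2 *: e_ R 1 - 2 *: e_ R 6 = lie (e_ R 4) (e_ R 5) by lie_basis.
have e7 : e_ R 7 = lie (e_ R 2) (e_ R 4) by lie_basis.
have e8 : e_ R 8 = lie (e_ R 2) (e_ R 5) by lie_basis.
have e1U : e_ R 1 \in U.
  by rewrite (@memv_unscale U (- 2)) ?e1 ?lieU ?oppr_eq0 ?pnatr_eq0.
have e6U : e_ R 6 \in U.
  rewrite (@memv_unscale U 2) ?pnatr_eq0 // -[_ *: _](subKr (2 *: e_ R 1)) e6.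
  by rewrite memvB ?memvZ // lieU.
have e7U : e_ R 7 \in U by rewrite e7 lieU.
have e8U : e_ R 8 \in U by rewrite e8 lieU.
by case=> [|[|[|[|[|[|[|[|[|j]]]]]]]]] // _; rewrite ?inU.
Qed.

(** The central element is diag(i, i, -2i), with centraliser h1. *)
Lemma complement_h1 (m : {vspace su21 R}) : reductive_with (h1 R) m -> m = m1 R.
Proof.
move=> red; apply: (complement_unique (c := 2 *: e_ R 6 - e_ R 1) red reductive_h1).
- by rewrite mem_h1 !(lamD, lamN, lamZ) !lam_e //= !(mulr0, subr0, eqxx).
- move=> x; rewrite mem_h1 => /and4P[/eqP? /eqP? /eqP? /eqP?].
  apply: lamP => j; case: j => [|[|[|[|[|[|[|[|[|j]]]]]]]]] //= _;
  rewrite !lam_lie // /lie_coords /plucker /= !(lam0, lamD, lamN, lamZ);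
  rewrite !lam_e //=; lra.
move=> x cx; have cx0 j : lam (lie (2 *: e_ R 6 - e_ R 1) x) j = 0.
  by rewrite cx lam0.
move: (cx0 4) (cx0 5) (cx0 7) (cx0 8); rewrite mem_h1.
rewrite !lam_lie // /lie_coords /plucker /= !(lam0, lamD, lamN, lamZ).
rewrite !lam_e //= => ????.
by apply/and4P; split; apply/eqP; lra.
Qed.

(** The central element is diag(2i, -i, -i), with centraliser h4. *)
Lemma complement_h4 (m : {vspace su21 R}) : reductive_with (h4 R) m -> m = m4 R.
Proof.
move=> red; apply: (complement_unique (c := e_ R 6 - 2 *: e_ R 1) red reductive_h4).
- by rewrite mem_h4 !(lamD, lamN, lamZ) !lam_e //= !(mulr0, subr0, eqxx).
- move=> x; rewrite mem_h4 => /and4P[/eqP? /eqP? /eqP? /eqP?].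
  apply: lamP => j; case: j => [|[|[|[|[|[|[|[|[|j]]]]]]]]] //= _;
  rewrite !lam_lie // /lie_coords /plucker /= !(lam0, lamD, lamN, lamZ);
  rewrite !lam_e //=; lra.
move=> x cx; have cx0 j : lam (lie (e_ R 6 - 2 *: e_ R 1) x) j = 0.
  by rewrite cx lam0.
move: (cx0 2) (cx0 3) (cx0 4) (cx0 5); rewrite mem_h4.
rewrite !lam_lie // /lie_coords /plucker /= !(lam0, lamD, lamN, lamZ).
rewrite !lam_e //= => ????.
by apply/and4P; split; apply/eqP; lra.
Qed.

End StandardPairs.

(** * The adjoint action and the transitivity of SU(2,1) on lines *)

Section Adjoint.
Variable R : realType.
Local Notation C := R[i].
Local Open Scope complex_scope.
Implicit Types (x y : su21 R) (g : 'M[C]_3) (U : {vspace su21 R}).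

Lemma SU21_unit g : is_SU21 g -> g \in unitmx.
Proof. by case=> _ dg; rewrite unitmxE dg unitr1. Qed.

Lemma SU21_inv g : is_SU21 g -> is_SU21 (invmx g).
Proof.
move=> gP; have gu := SU21_unit gP; case: gP => gJ dg.
split; last by rewrite det_inv dg invr1.
have cgu : conjT g \in unitmx by rewrite /conjT unitmx_tr map_unitmx.
have -> : conjT (invmx g) = invmx (conjT g).
  by rewrite /conjT map_invmx trmx_inv.
by rewrite -[in LHS]gJ !mulmxA mulVmx // mul1mx mulmxK.
Qed.

Lemma AdK g : is_SU21 g -> cancel (Ad g) (Ad (invmx g)).
Proof.
move=> gP x; apply: (can_inj (@su21_mxK R)).
rewrite !su21_mx_Ad //; last exact: SU21_inv.
have gu := SU21_unit gP.
by rewrite invmxK !mulmxA mulVmx // mul1mx mulmxKV.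
Qed.

Lemma Ad_lie g : is_SU21 g -> {morph Ad g : x y / lie x y}.
Proof.
move=> gP x y; apply: (can_inj (@su21_mxK R)); have gu := SU21_unit gP.
apply: etrans (su21_mx_Ad _ gP) (etrans _ (esym (su21_mx_lie _ _))).
rewrite (su21_mx_Ad x gP) (su21_mx_Ad y gP).
apply: etrans (congr1 (fun X => g *m X *m invmx g) (su21_mx_lie x y)) _.
generalize (su21_mx x) (su21_mx y) => X Y.
by rewrite /commmx mulmxBr mulmxBl !mulmxA !(mulmxKV gu).
Qed.

Lemma AdV_inv g U U' : is_SU21 g -> AdV g U = U' -> U = AdV (invmx g) U'.
Proof.
move=> gP <-; rewrite /AdV -limg_comp -[LHS]lim1g; apply: eq_in_limg => x _.
by rewrite comp_lfunE !lfunE /= AdK.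
Qed.

Lemma AdV_lker g : is_SU21 g -> lker (linfun (Ad g)) == 0%VS.
Proof.
move=> gP; apply/lker0P=> x y; rewrite !lfunE /=.
exact: (can_inj (AdK gP)).
Qed.

Lemma dim_AdV g U : is_SU21 g -> \dim (AdV g U) = \dim U.
Proof. by move=> /AdV_lker/eqP g0; rewrite limg_dim_eq // g0 capv0. Qed.

Lemma reductive_AdV g h m : is_SU21 g ->
  reductive_with h m -> reductive_with (AdV g h) (AdV g m).
Proof.
move=> gP; apply: reductive_with_img; first exact: AdV_lker.
by move=> x y; rewrite !lfunE /= Ad_lie.
Qed.

Lemma generates_AdV g m : is_SU21 g ->
  generates_lie m -> generates_lie (AdV g m).
Proof.
move=> gP; apply: generates_lie_img; first exact: AdV_lker.
by move=> x y; rewrite !lfunE /= Ad_lie.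
Qed.

Lemma mem_AdV g U y : is_SU21 g ->
  y \in AdV g U -> exists2 x, x \in U & y = Ad g x.
Proof. by move=> gP /memv_imgP[x xU ->]; exists x; rewrite ?lfunE. Qed.

End Adjoint.

Section Transitivity.
Variable R : realType.
Local Notation C := R[i].
Local Open Scope complex_scope.
Implicit Types (x y : su21 R) (g : 'M[C]_3) (u : 'rV[C]_3).

(** The real number u J21 u^*, whose sign decides between h1, h4 and the
   isotropic case. *)
Definition herm u : R :=
  let q z := complex.Re z ^+ 2 + complex.Im z ^+ 2 in
  q (u 0 0) + q (u 0 1) - q (u 0 2%R).

Definition row3 (a b c : C) : 'rV[C]_3 := \row_j nth 0 [:: a; b; c] j.

Lemma row3E u : u = row3 (u 0 0) (u 0 1) (u 0 2%R).
Proof.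
by apply/rowP=> -[[|[|[|//]]] ?]; rewrite !mxE; congr (u _ _); apply: val_inj.
Qed.

Lemma det2 (A : 'M[C]_2) : \det A = A 0 0 * A 1 1 - A 0 1 * A 1 0.
Proof.
rewrite (expand_det_row _ 0) !big_ord_recl big_ord0 /cofactor !det_mx11 !mxE.
rewrite /= addn0 expr0 expr1 mul1r mulN1r mulrN addr0.
by congr (_ * A _ _ - A _ _ * A _ _); apply: val_inj.
Qed.

Lemma det3 (A : 'M[C]_3) : \det A =
  A 0 0 * (A 1 1 * A 2%R 2%R - A 1 2%R * A 2%R 1)
  - A 0 1 * (A 1 0 * A 2%R 2%R - A 1 2%R * A 2%R 0)
  + A 0 2%R * (A 1 0 * A 2%R 1 - A 1 1 * A 2%R 0).
Proof.
have [F E] : exists F : nat -> nat -> C, forall i j, A i j = F i j.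
  by exists (fun m n => A (inord m) (inord n)) => i j; rewrite !inord_val.
rewrite (expand_det_row _ 0) !big_ord_recl big_ord0 /cofactor !det2.
rewrite !mxE.
rewrite !E /= /bump /=; ring.
Qed.

Lemma complexP (z w : C) :
  complex.Re z = complex.Re w -> complex.Im z = complex.Im w -> z = w.
Proof. by case: z w => [? ?] [? ?] /= -> ->. Qed.

Lemma J21_mul : J21 R *m J21 R = 1%:M.
Proof.
rewrite /J21; apply/matrixP=> i j.
rewrite mul_diag_mx !mxE; case: (i == j); rewrite ?mulr0 //=.
by rewrite -expr2 sqrr_sign.
Qed.

(** The defining equation concerns the columns of g; the equivalent equation
   on rows is the one that suits explicit matrices with a prescribed row. *)
Lemma SU21_of_rows g : g *m J21 R *m conjT g = J21 R -> \det g = 1 -> is_SU21 g.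
Proof.
move=> gJ dg; split=> //.
have J1 := J21_mul.
have: g *m (J21 R *m conjT g *m J21 R) = 1%:M by rewrite !mulmxA gJ.
move/mulmx1C => H.
rewrite -[LHS]mul1mx -J1 -!mulmxA [J21 R *m (conjT g *m _)]mulmxA.
by rewrite [J21 R *m conjT g *m _]mulmxA H mulmx1.
Qed.

(** Write u = (a, b, c).  The third row is a multiple of e_3 minus its
   projection on u, which has negative norm; the second row is orthogonal to u
   and to e_3. *)
Lemma SU21_positive u : herm u = 1 -> exists2 g, is_SU21 g & row 0 g = u.
Proof.
rewrite [u]row3E /herm !mxE /=.
case: (u 0 0) (u 0 1) (u 0 2%R) => [a1 a2] [b1 b2] [c1 c2] /= e.
pose s2 := 1 + (c1 ^+ 2 + c2 ^+ 2).
have s2_gt0 : 0 < s2 by rewrite ltr_wpDr ?ltr01 // addr_ge0 ?sqr_ge0.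
have [t ts] : exists t, t ^+ 2 * s2 = 1.
  by exists (Num.sqrt s2)^-1; rewrite exprVn sqr_sqrtr ?mulVf ?gt_eqF // ltW.
(* Multiples of the equation satisfied by u, so that the entries below are
   linear consequences of them. *)
have te : t ^+ 2 * (a1 ^+ 2 + a2 ^+ 2 + (b1 ^+ 2 + b2 ^+ 2)
   - (c1 ^+ 2 + c2 ^+ 2)) = t ^+ 2 by rewrite e mulr1.
exists (mx3 (a1 +i* a2) (b1 +i* b2) (c1 +i* c2)
  (t%:C * (- b1 +i* b2)) (t%:C * (a1 +i* - a2)) 0
  (t%:C * ((c1 +i* - c2) * (a1 +i* a2))) (t%:C * ((c1 +i* - c2) * (b1 +i* b2)))
  (t%:C * s2%:C)); last first.
  by apply/rowP=> -[[|[|[|//]]] ?]; rewrite !mxE.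
apply: SU21_of_rows; last first.
  rewrite det3 !mxE; apply: complexP => /=; rewrite /s2 in ts *; lra.
have t1 : t * c1 * (a1 ^+ 2 + a2 ^+ 2 + (b1 ^+ 2 + b2 ^+ 2)
   - (c1 ^+ 2 + c2 ^+ 2)) = t * c1 by rewrite e mulr1.
have t2 : t * c2 * (a1 ^+ 2 + a2 ^+ 2 + (b1 ^+ 2 + b2 ^+ 2)
   - (c1 ^+ 2 + c2 ^+ 2)) = t * c2 by rewrite e mulr1.
have t3 : t ^+ 2 * (c1 ^+ 2 + c2 ^+ 2) * (a1 ^+ 2 + a2 ^+ 2 + (b1 ^+ 2 + b2 ^+ 2)
   - (c1 ^+ 2 + c2 ^+ 2)) = t ^+ 2 * (c1 ^+ 2 + c2 ^+ 2) by rewrite e mulr1.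
rewrite /s2 {s2_gt0 s2} in ts *.
apply/matrixP=> -[[|[|[|//]]] ?] -[[|[|[|//]]] ?];
  rewrite /J21 /conjT !mxE !big_ord_recl !big_ord0 mul_mx_diag !mxE /=
    ?expr0 ?expr1 ?mulr1n ?mulr0n;
  apply: complexP => /=; lra.
Qed.
(** Write u = (a, b, c).  The first row is a multiple of e_1 minus its
   projection on u, which has positive norm; the second row is orthogonal to u
   and to e_1. *)
Lemma SU21_negative u : herm u = -1 -> exists2 g, is_SU21 g & row 2%R g = u.
Proof.
rewrite [u]row3E /herm !mxE /=.
case: (u 0 0) (u 0 1) (u 0 2%R) => [a1 a2] [b1 b2] [c1 c2] /= e.
pose s2 := 1 + (a1 ^+ 2 + a2 ^+ 2).
have s2_gt0 : 0 < s2 by rewrite ltr_wpDr ?ltr01 // addr_ge0 ?sqr_ge0.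
have [t ts] : exists t, t ^+ 2 * s2 = 1.
  by exists (Num.sqrt s2)^-1; rewrite exprVn sqr_sqrtr ?mulVf ?gt_eqF // ltW.
have ke k : k * (a1 ^+ 2 + a2 ^+ 2 + (b1 ^+ 2 + b2 ^+ 2)
   - (c1 ^+ 2 + c2 ^+ 2)) = - k by rewrite e mulrN1.
exists (mx3
  (t%:C * s2%:C) (t%:C * ((a1 +i* - a2) * (b1 +i* b2)))
    (t%:C * ((a1 +i* - a2) * (c1 +i* c2)))
  0 (t%:C * (c1 +i* - c2)) (t%:C * (b1 +i* - b2))
  (a1 +i* a2) (b1 +i* b2) (c1 +i* c2)); last first.
  by apply/rowP=> -[[|[|[|//]]] ?]; rewrite !mxE.
rewrite /s2 {s2_gt0 s2} in ts *.
(* The multiples of the equation satisfied by u that the entries below need. *)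
have := (ke (t ^+ 2), ke (t * a1), ke (t * a2), ke (t ^+ 2 * (a1 ^+ 2 + a2 ^+ 2))).
move=> [[[e1 e2] e3] e4] {ke}.
apply: SU21_of_rows; last first.
  rewrite det3 !mxE; apply: complexP => /=; lra.
apply/matrixP=> -[[|[|[|//]]] ?] -[[|[|[|//]]] ?];
  rewrite /J21 /conjT !mxE !big_ord_recl !big_ord0 mul_mx_diag !mxE /=
    ?expr0 ?expr1 ?mulr1n ?mulr0n;
  apply: complexP => /=; lra.
Qed.

Lemma SU21_isotropic u : herm u = 0 -> u 0 2%R = 1 ->
  exists2 g, is_SU21 g & row3 1 0 1 *m g = u.
Proof.
rewrite [u]row3E /herm !mxE /=.
case: (u 0 0) (u 0 1) (u 0 2%R) => [a1 a2] [b1 b2] c /= e c1.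
rewrite c1 /= in e; rewrite c1.
exists (mx3 (a1 +i* a2) (b1 +i* b2) 0 (- b1 +i* b2) (a1 +i* - a2) 0 0 0 1); last first.
  apply/rowP=> -[[|[|[|//]]] ?]; rewrite !mxE !big_ord_recl !big_ord0 !mxE /=;
  by rewrite !(mul0r, mul1r, mulr0, addr0, add0r).
apply: SU21_of_rows; last first.
  by rewrite det3 !mxE; apply: complexP => /=; lra.
apply/matrixP=> -[[|[|[|//]]] ?] -[[|[|[|//]]] ?];
  rewrite /J21 /conjT !mxE !big_ord_recl !big_ord0 mul_mx_diag !mxE /=
    ?expr0 ?expr1 ?mulr1n ?mulr0n;
  apply: complexP => /=; lra.
Qed.

Lemma herm_scale k u : herm (k *: u) =
  (complex.Re k ^+ 2 + complex.Im k ^+ 2) * herm u.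
Proof.
rewrite /herm !mxE; case: k (u 0 0) (u 0 1) (u 0 2%R) => [? ?] [? ?] [? ?] [? ?] /=.
ring.
Qed.

(** Row vectors are used, with the matrices of h acting on the right: the line
   through a row of g in SU(2,1) then corresponds under Ad g to the line
   through a basis vector. *)
Definition stable_line (h : {vspace su21 R}) u :=
  u != 0 /\ {in h, forall x, exists k, u *m su21_mx x = k *: u}.

Lemma stable_line_scale h u k :
  k != 0 -> stable_line h u -> stable_line h (k *: u).
Proof.
move=> k0 [u0 hu]; split; first by rewrite scaler_eq0 negb_or k0.
by move=> x /hu[l e]; exists l; rewrite -scalemxAl e !scalerA mulrC.
Qed.

Lemma stable_line_AdV h u v g : is_SU21 g -> v *m g = u ->
  stable_line h u -> stable_line (AdV g h) v.
Proof.
move=> gP vg [u0 hu]; have gu := SU21_unit gP.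
have ug : v = u *m invmx g by rewrite -vg mulmxK.
split; first by apply: contraNneq u0 => v0; rewrite -vg v0 mul0mx.
move=> _ /(mem_AdV gP)[x /hu[k e] ->]; exists k.
by rewrite (su21_mx_Ad _ gP) !mulmxA vg e -scalemxAl -ug.
Qed.

Lemma sub_h4 (h : {vspace su21 R}) : stable_line h (row3 1 0 0) -> (h <= h4 R)%VS.
Proof.
case=> _ hu; apply/subvP=> x /hu[k] /rowP e.
have := (e 1, e 2%R); rewrite su21_mxE !mxE !big_ord_recl !big_ord0 !mxE /=.
rewrite !(mul1r, mul0r, mulr0, addr0) mem_h4 => -[[/eqP + /eqP +] [-> ->]].
by rewrite !oppr_eq0 eqxx => -> ->.
Qed.

Lemma sub_h1 (h : {vspace su21 R}) : stable_line h (row3 0 0 1) -> (h <= h1 R)%VS.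
Proof.
case=> _ hu; apply/subvP=> x /hu[k] /rowP e.
have := (e 0, e 1); rewrite su21_mxE !mxE !big_ord_recl !big_ord0 !mxE /=.
rewrite !(mul1r, mul0r, mulr0, addr0, add0r) mem_h1 => -[[-> /eqP +] [-> /eqP +]].
by rewrite !oppr_eq0 eqxx => -> ->.
Qed.

End Transitivity.

(** * Identities for square matrices *)

Section Matrices.
Variable F : numFieldType.

(** From A^2 = 0 in size 3 one gets rank at most 1, so A = u v with u a column
   and v a row; both sides equal (v W u) u v. *)
Lemma square_zero_rank1 (A W : 'M[F]_3) :
  A *m A = 0 -> A *m W *m A = \tr (A *m W) *: A.
Proof.
move=> AA; have rA : (\rank A <= 1)%N.
  by have := mulmx0_rank_max AA; case: (\rank A) => [|[|r]] //; rewrite !addnS.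
rewrite -[A]mulmx_base; move: (col_base A) (row_base A).
case: (\rank A) rA => [|[|//]] _ u v.
  rewrite [u]thinmx0 !mul0mx scaler0. by [].
have -> : u *m v *m W *m (u *m v) = u *m (v *m W *m u) *m v.
  by rewrite !mulmxA.
have -> : \tr (u *m v *m W) = \tr (v *m W *m u).
  by rewrite -mulmxA mxtrace_mulC.
rewrite [v *m W *m u]mx11_scalar mul_mx_scalar -scalemxAl mxtrace_scalar.
by rewrite mulr1n.
Qed.

Lemma mxtrace_commmx n (S P Q : 'M[F]_n) :
  \tr (commmx S P *m Q) = \tr (S *m commmx P Q).
Proof.
rewrite /commmx mulmxBl mulmxBr (raddfB mxtrace) [RHS](raddfB mxtrace) !mulmxA.
congr (_ - _).
by rewrite -[P *m S *m Q]mulmxA [LHS]mxtrace_mulC.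
Qed.

(** The coefficients of the characteristic polynomial are expressed by power
   sums, because traces of powers are what the trace form controls. *)
Lemma Cayley_Hamilton3 (A : 'M[F]_3) :
  A ^+ 3 = \tr A *: A ^+ 2 + ((\tr (A ^+ 2) - \tr A ^+ 2) / 2) *: A
    + (\tr (A ^+ 3) / 3 - \tr A * \tr (A ^+ 2) / 2 + \tr A ^+ 3 / 6)%:M.
Proof.
have [f E] : exists f : nat -> nat -> F, forall i j, A i j = f i j.
  by exists (fun m n => A (inord m) (inord n)) => i j; rewrite !inord_val.
pose f2 i j := f i 0%N * f 0%N j + (f i 1%N * f 1%N j + f i 2%N * f 2%N j).
pose f3 i j := f i 0%N * f2 0%N j + (f i 1%N * f2 1%N j + f i 2%N * f2 2%N j).
have E2 (i j : 'I_3) : (A ^+ 2) i j = f2 i j.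
  by rewrite expr2 mxE !big_ord_recl big_ord0 !E addr0.
have E3 (i j : 'I_3) : (A ^+ 3) i j = f3 i j.
  by rewrite exprS mxE !big_ord_recl big_ord0 !E2 !E addr0.
have tr3 (B : 'M[F]_3) (b : nat -> nat -> F) : (forall i j : 'I_3, B i j = b i j) ->
    \tr B = b 0%N 0%N + (b 1%N 1%N + b 2%N 2%N).
  by move=> Bb; rewrite /mxtrace !big_ord_recl big_ord0 addr0 !Bb.
rewrite (tr3 _ _ E) (tr3 _ _ E2) (tr3 _ _ E3).
(* The powers are made opaque, so that only E2 and E3 expand their entries. *)
move: (A ^+ 2) (A ^+ 3) E2 E3 => A2 A3 E2 E3.
apply/matrixP=> -[[|[|[|//]]] ?] -[[|[|[|//]]] ?];
  rewrite !mxE !E !E2 !E3 /f3 /f2 /= ?mulr1n ?mulr0n; by field.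
Qed.

Lemma Cayley_Hamilton3_traceless (A : 'M[F]_3) : \tr A = 0 ->
  A ^+ 3 = (\tr (A ^+ 2) / 2) *: A + (\tr (A ^+ 3) / 3)%:M.
Proof.
move=> t; rewrite {1}Cayley_Hamilton3 t !expr0n /=.
by rewrite !(mul0r, scale0r, add0r, subr0, addr0).
Qed.

Section AdPowers.
Variables (n : nat) (A Y : 'M[F]_n.+1).
Let T p q := A ^+ p *m Y *m A ^+ q.

Let commT p q : commmx A (T p q) = T p.+1 q - T p q.+1.
Proof. by rewrite /commmx /T exprS exprSr !mulmxE !mulrA. Qed.

(** Left and right multiplication by A commute, so this is the binomial
   expansion of a power of their difference. *)
Lemma iter4_comm : iter 4 (commmx A) Y =
  T 4 0 - 4 *: T 3 1 + 6 *: T 2 2 - 4 *: T 1 3 + T 0 4.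
Proof.
have <- : T 0 0 = Y by rewrite /T expr0 mul1mx mulmx1.
have cT := commT.
have L B D : commmx A (B - D) = commmx A B - commmx A D.
  by rewrite -scaleN1r addrC commmx_linearr scaleN1r addrC.
move: (commmx A) L cT => c L cT; rewrite /= !(L, cT).
move: T => S. by apply/matrixP=> i j; rewrite !mxE; ring.
Qed.

Lemma iter5_comm : iter 5 (commmx A) Y =
  T 5 0 - 5 *: T 4 1 + 10 *: T 3 2 - 10 *: T 2 3 + 5 *: T 1 4 - T 0 5.
Proof.
have <- : T 0 0 = Y by rewrite /T expr0 mul1mx mulmx1.
have cT := commT.
have L B D : commmx A (B - D) = commmx A B - commmx A D.
  by rewrite -scaleN1r addrC commmx_linearr scaleN1r addrC.
move: (commmx A) L cT => c L cT; rewrite /= !(L, cT).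
by move: T {cT} => S; apply/matrixP=> i j; rewrite !mxE; ring.
Qed.

End AdPowers.

Lemma iter4_comm_nil (A Y : 'M[F]_3) : A ^+ 3 = 0 ->
  iter 4 (commmx A) Y = 6 *: (A ^+ 2 *m Y *m A ^+ 2).
Proof.
move=> A3; rewrite iter4_comm [A ^+ 4]exprS A3 !(mulr0, mul0mx, mulmx0).
by rewrite !(scaler0, oppr0, addr0, add0r).
Qed.

(** If the cube of A is d, the binomial coefficients 1, 5, 10, 10, 5, 1 fold
   modulo 3 and leave -9 d on A^2 Y and its opposite on Y A^2. *)
Lemma iter5_comm_cube (A Y : 'M[F]_3) d : A ^+ 3 = d%:M ->
  iter 5 (commmx A) Y = (- 9 * d) *: commmx (A ^+ 2) Y.
Proof.
move=> A3; rewrite iter5_comm.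
have A4 : A ^+ 4 = d *: A by rewrite exprS A3 -mulmxE mul_mx_scalar.
have A5 : A ^+ 5 = d *: A ^+ 2.
  by rewrite exprS A4 -mulmxE -scalemxAr mulmxE -expr2.
rewrite A4 A5 A3 /commmx !expr0 !expr1 !(mul1mx, mulmx1, mul_mx_scalar).
rewrite !mul_scalar_mx -!scalemxAl -!scalemxAr.
move: (A ^+ 2 *m Y) (A *m Y *m A) (Y *m A ^+ 2) => S T U.
by apply/matrixP=> i j; rewrite !mxE; ring.
Qed.

End Matrices.

(** * The trace form, and elements of a reductive subalgebra orthogonal to it *)

Section TraceForm.
Variable R : realType.
Local Notation C := R[i].
Local Open Scope complex_scope.
Implicit Types (x y z c : su21 R) (h m : {vspace su21 R}).
Local Notation mx := (@su21_mx R).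

Lemma mx_lie x y : mx (lie x y) = commmx (mx x) (mx y).
Proof. exact: su21_mx_lie. Qed.

Lemma mx_iter_lie n x y : mx (iter n (lie x) y) = iter n (commmx (mx x)) (mx y).
Proof. by elim: n => // n IH; rewrite !iterS -IH mx_lie. Qed.

Definition trace_form x y : R := complex.Re (\tr (mx x *m mx y)).

Lemma trace_formE x y : trace_form x y =
  - (lam x 1 * lam y 1) - (lam x 1 + lam x 6) * (lam y 1 + lam y 6)
  - lam x 6 * lam y 6 - 2 * (lam x 2 * lam y 2 + lam x 3 * lam y 3)
  + 2 * (lam x 4 * lam y 4 + lam x 5 * lam y 5)
  + 2 * (lam x 7 * lam y 7 + lam x 8 * lam y 8).
Proof.
rewrite /trace_form !su21_mxE /mxtrace !big_ord_recl big_ord0 !mxE.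
by rewrite !big_ord_recl !big_ord0 !mxE /=; ring.
Qed.

Lemma mxtrace_trace_form x y : \tr (mx x *m mx y) = (trace_form x y)%:C.
Proof.
rewrite trace_formE !su21_mxE /mxtrace !big_ord_recl big_ord0 !mxE.
by rewrite !big_ord_recl !big_ord0 !mxE /=; apply: complexP => /=; ring.
Qed.

Lemma trace_form_nondegenerate x : (forall y, trace_form x y = 0) -> x = 0.
Proof.
move=> x0.
have e j : (0 < j < 9)%N -> trace_form x (e_ R j) = 0 by [].
have := (e 1 isT, e 2 isT, e 3 isT, e 4 isT, e 5 isT, e 6 isT, e 7 isT, e 8 isT)%N.
rewrite !trace_formE !lam_e //= {e x0} => -[[[[[[[]]]]]]] *.
apply: lamP => -[|[|[|[|[|[|[|[|[|?]]]]]]]]] //= _; rewrite lam0.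
all: lra.
Qed.

Lemma trace_form_lie x y z : trace_form (lie x y) z = trace_form x (lie y z).
Proof.
rewrite /trace_form; generalize (mx_lie x y) (mx_lie y z).
generalize (mx (lie x y)) (mx (lie y z)) (mx x) (mx y) (mx z).
by move=> _ _ X Y Z -> ->; rewrite mxtrace_commmx.
Qed.

Lemma trace_formC x y : trace_form x y = trace_form y x.
Proof. by rewrite /trace_form mxtrace_mulC. Qed.

Lemma trace_form_linear a x y z :
  trace_form (a *: x + y) z = a * trace_form x z + trace_form y z.
Proof. by rewrite !trace_formE !lam_linear; ring. Qed.

Lemma trace_formN x y : trace_form (- x) y = - trace_form x y.
Proof. by rewrite !trace_formE !lamN; ring. Qed.

Lemma trace_form_split h m x : reductive_with h m ->
  {in h, forall y, trace_form x y = 0} ->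
  {in m, forall y, trace_form x y = 0} -> x = 0.
Proof.
case=> _ mh _ _ xh xm; apply: trace_form_nondegenerate => y.
have : y \in (m + h)%VS by rewrite mh memvf.
case/memv_addP=> u um [v vh ->].
rewrite trace_formC -[u]scale1r trace_form_linear trace_formC xm //.
by rewrite trace_formC xh // mulr0 addr0.
Qed.

Lemma lie_lie_square_zero x y :
  mx x *m mx x = 0 -> lie x (lie x y) = (- 2 * trace_form x y) *: x.
Proof.
move=> xx; apply: (can_inj (@su21_mxK R)).
apply: etrans (mx_lie _ _) _; rewrite mx_lie.
have -> : mx ((- 2 * trace_form x y) *: x) = (- 2 * trace_form x y)%:C *: mx x.
  by have := su21_mx_linear (- 2 * trace_form x y) x 0; rewrite su21_mx0 !addr0.
rewrite rmorphM /= -scalerA -mxtrace_trace_form.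
move: (mx x) (mx y) xx => X Y XX {x y}; rewrite -square_zero_rank1 // /commmx.
rewrite mulmxBr mulmxBl !mulmxA XX mul0mx sub0r -[Y *m X *m X]mulmxA XX mulmx0.
by rewrite subr0 rmorphN /= scaleNr rmorph_nat scaler_nat mulr2n opprD.
Qed.

(** For y in m the element (ad x)^2 y is in m, but it is a multiple of x, which
   is in h; so the factor tr(x y) vanishes. *)
Lemma square_zero_orthogonal h m x : reductive_with h m -> x \in h ->
  mx x *m mx x = 0 -> {in h, forall y, trace_form x y = 0} -> x = 0.
Proof.
move=> red xh xx xhb; apply: (trace_form_split red xhb) => y ym.
have [_ _ mh0 hm] := red.
have xxm : lie x (lie x y) \in m by rewrite !hm.
have : (- 2 * trace_form x y) *: x \in (m :&: h)%VS.
  by rewrite memv_cap (memvZ _ xh) andbT; move: xxm; rewrite lie_lie_square_zero.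
rewrite mh0 memv0 scaler_eq0 => /orP[|/eqP->].
  by rewrite mulf_eq0 oppr_eq0 pnatr_eq0 => /eqP.
by rewrite trace_formE !lam0; ring.
Qed.

(** X is skew for the form, so X^2 is self-adjoint and i X^2 is skew again. *)
Lemma in_su21_isquare x : \tr (mx x ^+ 2) = 0 ->
  exists z, mx z = 'i *: mx x ^+ 2.
Proof.
move=> t2; apply/su21_mxP; have [XJ _] := su21_mx_in x.
split; last by rewrite mxtraceZ t2 mulr0.
have {}XJ : conjT (mx x) *m J21 R = - (J21 R *m mx x).
  by apply/eqP; rewrite -addr_eq0 XJ.
have -> : conjT ('i *: mx x ^+ 2) = - 'i *: (conjT (mx x) *m conjT (mx x)).
  rewrite /conjT map_mxZ linearZ /= expr2 -mulmxE map_mxM trmx_mul.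
  by congr (_ *: _); apply: complexP => /=; rewrite ?oppr0.
rewrite -scalemxAl -mulmxA XJ mulmxN mulmxA XJ mulNmx opprK -scalemxAr expr2.
by rewrite scaleNr mulmxA addNr.
Qed.

(** Since (ad x)^4 vanishes on both 4-dimensional spaces, it vanishes on su(2,1),
   where it is y |-> 6 x^2 y x^2.  The square-zero element z = i x^2 then
   satisfies z y z = 0, that is tr(z y) z = 0, for all y. *)
Lemma nilpotent_square h m x : reductive_with h m -> \dim h = 4%N ->
  x \in h -> mx x ^+ 3 = 0 -> mx x ^+ 2 = 0.
Proof.
move=> red dh xh x3.
have dm : \dim m = 4%N.
  have := reductive_dim red; rewrite dh (_ : \dim {:su21 R} = 4 + 4)%N.
    by move/addIn.
  exact: dimvf.
have [hh mh _ hm] := red.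
pose f := linfun (lie x).
have fE n y : iter n f y = iter n (lie x) y.
  by elim: n => // n IH; rewrite !iterS IH lfunE.
have f5 y : iter 5 f y = 0.
  apply: (can_inj (@su21_mxK R)); rewrite fE mx_iter_lie su21_mx0.
  by rewrite (iter5_comm_cube _ (d := 0)) ?mulr0 ?scale0r // x3 raddf0.
have fU U : \dim U = 4%N -> (forall y, y \in U -> lie x y \in U) ->
    {in U, forall y, iter 4 f y = 0}.
  move=> dU xU y yU; rewrite -dU; apply: (nilpotent_iter_dim (n := 5)) => //.
  by apply/subvP=> _ /memv_imgP[v vU ->]; rewrite lfunE xU.
have f4 y : iter 4 f y = 0.
  have : y \in (m + h)%VS by rewrite mh memvf.
  case/memv_addP=> u um [v vh ->].
  have D n : iter n f (u + v) = iter n f u + iter n f v.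
    by elim: n => // n IH; rewrite !iterS IH linearD.
  by rewrite D (fU m dm (hm x ^~ xh)) ?(fU h dh (hh x ^~ xh)) ?addr0.
have q y : mx x ^+ 2 *m mx y *m mx x ^+ 2 = 0.
  apply/eqP; have /eqP := congr1 mx (f4 y).
  by rewrite fE mx_iter_lie iter4_comm_nil // su21_mx0 scaler_eq0 pnatr_eq0.
have x4 : mx x ^+ 2 *m mx x ^+ 2 = 0.
  by rewrite mulmxE -exprD exprS x3 mulr0.
have [z zE] : exists z, mx z = 'i *: mx x ^+ 2.
  apply: in_su21_isquare.
  have [_ /Cayley_Hamilton3_traceless] := su21_mx_in x.
  rewrite x3 raddf0 mul0r raddf0 addr0 => /esym/eqP.
  rewrite scaler_eq0 mulf_eq0 invr_eq0 pnatr_eq0 orbF => /orP[/eqP//|/eqP->].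
  by rewrite expr0n raddf0.
suff Z0 : mx z = 0.
  move: zE; rewrite Z0 => /esym/eqP; rewrite scaler_eq0 => /orP[|/eqP//].
  by rewrite eq_complex /= oner_eq0 andbF.
have zyz y : mx z *m mx y *m mx z = 0.
  by rewrite zE -!scalemxAl -scalemxAr q !scaler0.
apply/eqP; case: eqP => // /eqP Z0; rewrite -(negPf Z0).
suff -> : z = 0 by rewrite su21_mx0.
apply: trace_form_nondegenerate => y; apply/eqP.
have : \tr (mx z *m mx y) *: mx z = 0.
  have zz : mx z *m mx z = 0 by rewrite zE -scalemxAl -scalemxAr x4 !scaler0.
  exact: etrans (esym (square_zero_rank1 _ zz)) (zyz y).
move/eqP; rewrite scaler_eq0 (negPf Z0) orbF mxtrace_trace_form.
by rewrite -[0]/(0%:C) (inj_eq (@complexI _)).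
Qed.

(** With x^3 = d, invariance of the trace form gives
   0 = tr((ad x)^5 c y) = -9 d tr([x^2, c] y) = -9 d tr(x^2 [c, y]) = -27 d^2. *)
Lemma commutator_orthogonal h m x c y : reductive_with h m -> \dim h = 4%N ->
  c \in h -> y \in h -> x = lie c y ->
  {in h, forall y, trace_form x y = 0} -> x = 0.
Proof.
move=> red dh ch yh xcy xhb; have [hh _ _ _] := red.
have xh : x \in h by rewrite xcy hh.
have iterh n : iter n (lie x) c \in h.
  by elim: n => // n IH; rewrite iterS hh.
have tr2 : \tr (mx x ^+ 2) = 0 by rewrite expr2 -mulmxE mxtrace_trace_form xhb.
have [_ /Cayley_Hamilton3_traceless] := su21_mx_in x.
rewrite tr2 mul0r scale0r add0r => x3.
have [d {}x3 trd] : exists2 d, mx x ^+ 3 = d%:M & \tr (mx x ^+ 3) = 3 * d.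
  by exists (\tr (mx x ^+ 3) / 3); rewrite // mulrC divfK // pnatr_eq0.
have d0 : d = 0.
  have : \tr (mx (iter 5 (lie x) c) *m mx y) = 0.
    by rewrite mxtrace_trace_form iterS trace_form_lie xhb // hh.
  rewrite mx_iter_lie (iter5_comm_cube _ x3) -scalemxAl mxtraceZ.
  have -> : \tr (commmx (mx x ^+ 2) (mx c) *m mx y) = 3 * d.
    rewrite mxtrace_commmx -trd [mx x ^+ 3]exprSr -mulmxE.
    by congr (\tr (_ *m _)); apply: etrans (esym (mx_lie c y)) _; rewrite xcy.
  move=> /eqP; rewrite !mulf_eq0 oppr_eq0 !pnatr_eq0 /= orbb.
  by move/eqP.
have {}x3 : mx x ^+ 3 = 0 by rewrite x3 d0 raddf0.
apply: (square_zero_orthogonal red xh _ xhb).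
by rewrite mulmxE -expr2 (nilpotent_square red dh xh).
Qed.

End TraceForm.

(** * A reductive four-dimensional subalgebra stabilises a non-isotropic line *)

Section StableLine.
Variable R : realType.
Local Notation C := R[i].
Local Open Scope complex_scope.
Implicit Types (x y z c : su21 R) (h m : {vspace su21 R}) (u : 'rV[C]_3).
Local Notation mx := (@su21_mx R).

(** A kernel vector of the invariant 3-form tr([x, y] z) on h commutes with h,
   by commutator_orthogonal. *)
Lemma central_element h m : reductive_with h m -> \dim h = 4%N ->
  exists c, [/\ c \in h, c != 0 & {in h, forall y, lie c y = 0}].
Proof.
move=> red dh; have [hh _ _ _] := red.
have [|||| c [ch c0 cP]] :=
    @alternating3_kernel _ _ (fun x y z => trace_form (lie x y) z) h _ _ _ _ dh.
- by move=> a x x' y z; rewrite lie_linearl trace_form_linear.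
- by move=> x y z; rewrite lieC trace_formN.
- move=> x y z; apply: etrans (trace_form_lie x z y) _.
  apply: etrans (congr1 -%R (esym (trace_form_lie x y z))).
  by rewrite (lieC y z) trace_formC trace_formN trace_formC.
- by move=> x z; rewrite lie_alt trace_formE !lam0; ring.
exists c; split=> // y yh; apply: (commutator_orthogonal red dh ch yh) => // z zh.
exact: cP.
Qed.

(** A stable row space of rank 1 is the line through any of its nonzero rows. *)
Lemma rank1_stable_line h (K : 'M[C]_3) : \rank K = 1%N ->
  {in h, forall y, K *m mx y <= K}%MS -> exists u, stable_line h u.
Proof.
move=> K1 Kh; exists (nz_row K).
have u0 : nz_row K != 0 by rewrite nz_row_eq0 -mxrank_eq0 K1.
have Ku : (K <= nz_row K)%MS.
  by rewrite -(geq_leqif (mxrank_leqif_sup (nz_row_sub K))) K1 lt0n mxrank_eq0.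
split=> // y /Kh Ky; apply/sub_rVP.
exact: submx_trans (submxMr _ (nz_row_sub K)) (submx_trans Ky Ku).
Qed.

(** Take B = c - l with l an eigenvalue of c.  Its rank is neither 0, as c has
   trace 0, nor 3.  In rank 1 the row space of B is the line, in rank 2 the
   kernel is; both are stable because B commutes with h. *)
Lemma central_stable_line h c : c != 0 -> {in h, forall y, lie c y = 0} ->
  exists u, stable_line h u.
Proof.
move=> c0 ch.
have [l lA] : exists l, eigenvalue (mx c) l.
  have /closed_rootP[l] : size (char_poly (mx c)) != 1%N by rewrite size_char_poly.
  by exists l; rewrite eigenvalue_root_char.
pose B := mx c - l%:M.
have Bh : {in h, forall y, B *m mx y = mx y *m B}.
  move=> y yh; rewrite mulmxBl mulmxBr mul_scalar_mx mul_mx_scalar.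
  congr (_ - _); apply/eqP; rewrite -subr_eq0; apply/eqP.
  by apply: etrans (esym (mx_lie c y)) _; rewrite ch // su21_mx0.
have rB0 : \rank B != 0%N.
  rewrite mxrank_eq0 subr_eq0; apply: contra c0 => /eqP cl.
  have [_ trc] := su21_mx_in c.
  move: trc; rewrite cl mxtrace_scalar => /eqP.
  rewrite mulrn_eq0 /= => /eqP l0.
  by rewrite -(can_eq (@su21_mxK R)) cl l0 su21_mx0 raddf0.
have rB3 : (\rank B < 3)%N.
  rewrite ltnNge; apply: contraL lA => rB.
  rewrite negbK /eigenspace kermx_eq0 /row_free eqn_leq rank_leq_row.
  exact: rB.
have [r1|r1] := eqVneq (\rank B) 1%N.
  by apply: (rank1_stable_line r1) => y yh; rewrite Bh // submxMl.
apply: (@rank1_stable_line h (kermx B)).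
  rewrite mxrank_ker; move: rB0 rB3 r1; by case: (\rank B) => [|[|[|]]].
move=> y yh; apply/sub_kermxP; rewrite -mulmxA -Bh // mulmxA.
by rewrite mulmx_ker mul0mx.
Qed.

(** In the stabiliser of the line of (1, 0, 1), the kernel of levi_part is the
   nilradical, a Heisenberg algebra with centre spanned by e_1 - e_5 - e_6;
   nil_part gives the coordinates of the nilradical modulo its centre. *)
Definition levi_part x : 'rV[R]_2 := \row_j [:: lam x 4; lam x 1 + lam x 5]`_j.
Definition nil_part x : 'rV[R]_2 := \row_j [:: lam x 2; lam x 3]`_j.

Lemma levi_part_linear : linear levi_part.
Proof.
move=> a x y; apply/rowP=> -[[|[|//]] ?]; rewrite !mxE /= !lam_linear //; ring.
Qed.

Lemma nil_part_linear : linear nil_part.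
Proof.
by move=> a x y; apply/rowP=> -[[|[|//]] ?]; rewrite !mxE /= !lam_linear.
Qed.

HB.instance Definition _ :=
  GRing.isLinear.Build R (su21 R) 'rV[R]_2 *:%R levi_part levi_part_linear.
HB.instance Definition _ :=
  GRing.isLinear.Build R (su21 R) 'rV[R]_2 *:%R nil_part nil_part_linear.

(** The intersection K of h with the nilradical has dimension at least 2.
   Either K meets the centre, or K maps onto the nilradical modulo its centre,
   and then the commutator of two elements of K is a nonzero central one. *)
Lemma nilradical_center_mem h : is_subalgebra h -> \dim h = 4%N ->
  stable_line h (row3 1 0 1) -> e_ R 1 - e_ R 5 - e_ R 6 \in h.
Proof.
move=> hh dh [_ hu]; set z := (X in X \in h).
have hP x : x \in h ->
    [/\ lam x 7 = lam x 2, lam x 8 = - lam x 3 & lam x 6 = lam x 1 + 2 * lam x 5].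
  case/hu=> k /rowP e; have := (e 0, e 1, e 2%R).
  rewrite su21_mxE !mxE !big_ord_recl !big_ord0 !mxE /=.
  rewrite !(mul1r, mul0r, mulr0, mulr1, addr0, add0r) => -[[+ +] +].
  case: k {e} => k1 k2 [e1 e2] [e3 e4] [e5 e6]; split; lra.
have d2 : \dim {: 'rV[R]_2} = 2%N by exact: dimvf.
pose K := (h :&: lker (linfun levi_part))%VS.
(* levi_part has values in a plane and h has dimension 4. *)
have dK : (2 <= \dim K)%N.
  have := limg_ker_dim (linfun levi_part) h; rewrite dh => e.
  rewrite -(leq_add2r (\dim (linfun levi_part @: h))) e.
  by rewrite (leq_add2l 2 _ 2) (leq_trans (dimvS (subvf _))) ?d2.
have KP x : x \in K -> [/\ x \in h, lam x 4 = 0 & lam x 5 = - lam x 1].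
  rewrite memv_cap memv_ker lfunE /= => /andP[xh /eqP/rowP e]; split=> //.
    by have := e 0; rewrite !mxE.
  by have := e 1; rewrite !mxE /= => /eqP; rewrite addrC addr_eq0 => /eqP.
have zP x (k : R) : x \in K -> lam x 1 = k -> lam x 2 = 0 -> lam x 3 = 0 ->
    x = k *: z.
  move=> /KP[/hP[e7 e8 e6] e4 e5] e1 e2 e3.
  apply: lamP => -[|[|[|[|[|[|[|[|[|?]]]]]]]]] //= _;
    rewrite lamZ !lamD !lamN !lam_e //=; lra.
have zh x (k : R) : x \in h -> x = k *: z -> k != 0 -> z \in h.
  by move=> xh e k0; apply: (memv_unscale k0); rewrite -e.
have nP x : (x \in lker (linfun nil_part)) = (lam x 2 == 0) && (lam x 3 == 0).
  rewrite memv_ker lfunE /=; apply/eqP/andP => [/rowP e|[/eqP e2 /eqP e3]].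
    by have := (e 0, e 1); rewrite !mxE /= => -[-> ->].
  by apply/rowP=> -[[|[|//]] ?]; rewrite !mxE /= ?e2 ?e3.
have [N0|] := eqVneq (K :&: lker (linfun nil_part))%VS 0%VS; last first.
  rewrite -vpick0; set x := vpick _ => x0.
  have : x \in (K :&: lker (linfun nil_part))%VS by exact: memv_pick.
  rewrite memv_cap nP => /and3P[xK /eqP x2 /eqP x3].
  have xz := zP x _ xK erefl x2 x3; have [xh _ _] := KP x xK.
  by apply: (zh x _ xh xz); apply: contraNneq x0 => x1; rewrite xz x1 scale0r.
have full : (linfun nil_part @: K)%VS = fullv.
  apply/eqP; rewrite eqEdim subvf d2 /=.
  by have := limg_ker_dim (linfun nil_part) K; rewrite N0 dimv0 add0n => ->.
have pick v : exists2 x, x \in K & nil_part x = v.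
  have : v \in (linfun nil_part @: K)%VS by rewrite full memvf.
  by case/memv_imgP=> x xK ->; exists x => //; rewrite lfunE.
have [x xK /rowP xv] := pick (\row_j [:: 1; 0]`_j).
have [y yK /rowP yv] := pick (\row_j [:: 0; 1]`_j).
have := (xv 0, xv 1, yv 0, yv 1); rewrite !mxE /= => -[[[x2 x3] y2] y3].
have [xh x4 x5] := KP x xK; have [yh y4 y5] := KP y yK.
have [x7 x8 x6] := hP x xh; have [y7 y8 y6] := hP y yh.
apply: (zh (lie x y) (-2) (hh x y xh yh)); last by rewrite oppr_eq0 pnatr_eq0.
apply/esym/eq_lie => -[|[|[|[|[|[|[|[|[|?]]]]]]]]] //= _;
  rewrite /plucker lamZ !lamD !lamN !lam_e //=;
  rewrite ?x8 ?x7 ?x6 ?x5 ?x4 ?x3 ?x2 ?y8 ?y7 ?y6 ?y5 ?y4 ?y3 ?y2; ring.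
Qed.

(** The central element of the nilradical has square zero and is orthogonal to
   the whole stabiliser of the line. *)
Lemma not_standard_isotropic_line h m : reductive_with h m -> \dim h = 4%N ->
  ~ stable_line h (row3 1 0 1).
Proof.
move=> red dh hu; have [hh _ _ _] := red.
have zh := nilradical_center_mem hh dh hu.
have z0 : e_ R 1 - e_ R 5 - e_ R 6 = 0.
  apply: (square_zero_orthogonal red zh).
    rewrite su21_mxE !lamD !lamN !lam_e //=.
    apply/matrixP=> -[[|[|[|//]]] ?] -[[|[|[|//]]] ?];
    by rewrite !mxE !big_ord_recl !big_ord0 !mxE /=; apply: complexP => /=; ring.
  move=> x xh; rewrite trace_formE !lamD !lamN !lam_e //=.
  case: hu => _ hu; have [k /rowP e] := hu x xh.
  have := (e 0, e 2%R); rewrite su21_mxE !mxE !big_ord_recl !big_ord0 !mxE /=.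
  rewrite !(mul1r, mul0r, mulr0, mulr1, addr0, add0r) => -[+ +].
  case: k {e} => k1 k2 [e1 e2] [e3 e4]; lra.
have := congr1 (fun x => lam x 1) z0; rewrite /= lam0 !lamD !lamN !lam_e //= => /eqP.
by rewrite !subr0 oner_eq0.
Qed.

Lemma stable_line_not_isotropic h m u : reductive_with h m -> \dim h = 4%N ->
  stable_line h u -> herm u != 0.
Proof.
move=> red dh hu; apply/eqP => u0.
have [uc|uc] := eqVneq (u 0 2%R) 0.
  case: hu => /eqP[]; rewrite [u]row3E uc; move: u0; rewrite /herm uc /=.
  case: (u 0 0) (u 0 1) => [a1 a2] [b1 b2] /= => e.
  have [-> -> -> ->] : [/\ a1 = 0, a2 = 0, b1 = 0 & b2 = 0].
    by split; nra.
  by apply/rowP=> -[[|[|[|//]]] ?]; rewrite !mxE.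
have k0 : (u 0 2%R)^-1 != 0 by rewrite invr_eq0.
have ku0 : herm ((u 0 2%R)^-1 *: u) = 0 by rewrite herm_scale u0 mulr0.
have ku1 : ((u 0 2%R)^-1 *: u) 0 2%R = 1 by rewrite mxE mulVf.
have [g gP gu] := SU21_isotropic ku0 ku1.
apply: (not_standard_isotropic_line (reductive_AdV gP red)); first by rewrite dim_AdV.
exact: stable_line_AdV gP gu (stable_line_scale k0 hu).
Qed.

Lemma herm_normalize u : herm u != 0 ->
  exists2 k, k != 0 & herm (k *: u) = Num.sg (herm u).
Proof.
move=> u0; have n0 : 0 < `|herm u| by rewrite normr_gt0.
exists (Num.sqrt `|herm u|)^-1%:C.
  by rewrite eq_complex /= eqxx andbT invr_eq0 sqrtr_eq0 -ltNge.
rewrite herm_scale /= expr0n addr0 exprVn sqr_sqrtr ?ltW //.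
by rewrite [X in _ * X]numEsg mulrCA mulVf ?mulr1 ?normr_eq0.
Qed.

Lemma row_delta3 (g : 'M[C]_3) :
  row3 1 0 0 *m g = row 0 g /\ row3 0 0 1 *m g = row 2%R g.
Proof.
by rewrite !rowE; split; congr (_ *m g);
  apply/rowP=> -[[|[|[|//]]] ?]; rewrite !mxE.
Qed.

Lemma classification h m : reductive_with h m -> \dim h = 4%N ->
  exists g : 'M[C]_3, is_SU21 g /\
    ((AdV g h = h1 R /\ AdV g m = m1 R) \/ (AdV g h = h4 R /\ AdV g m = m4 R)).
Proof.
move=> red dh.
have [c [_ c0 cP]] := central_element red dh.
have [u hu] := central_stable_line c0 cP.
have u0 := stable_line_not_isotropic red dh hu.
have [k k0 ku] := herm_normalize u0.
have {}hu := stable_line_scale k0 hu.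
have [up|un] : Num.sg (herm u) = 1 \/ Num.sg (herm u) = -1.
- by move: u0; rewrite neq_lt => /orP[/ltr0_sg|/gtr0_sg] ->; [right|left].
- have [g gP gu] := SU21_positive (etrans ku up).
  have {}red := reductive_AdV gP red.
  have eh : AdV g h = h4 R.
    apply/eqP; rewrite eqEdim dim_AdV // dh dim_h4 andbT.
    by apply: sub_h4; apply: stable_line_AdV gP _ hu; rewrite -gu (row_delta3 g).1.
  exists g; split=> //; right; split=> //.
  by apply: complement_h4; rewrite -eh.
have [g gP gu] := SU21_negative (etrans ku un).
have {}red := reductive_AdV gP red.
have eh : AdV g h = h1 R.
  apply/eqP; rewrite eqEdim dim_AdV // dh dim_h1 andbT.
  by apply: sub_h1; apply: stable_line_AdV gP _ hu; rewrite -gu (row_delta3 g).2.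
exists g; split=> //; left; split=> //.
by apply: complement_h1; rewrite -eh.
Qed.

Lemma conjugate_pair (g : 'M[C]_3) h m h' m' : is_SU21 g ->
  AdV g h = h' -> AdV g m = m' ->
  reductive_with h' m' -> \dim h' = 4%N -> generates_lie m' ->
  [/\ reductive_with h m, \dim h = 4%N & generates_lie m].
Proof.
move=> gP eh em red dh gen; have gP' := SU21_inv gP.
rewrite (AdV_inv gP eh) (AdV_inv gP em).
split; [exact: reductive_AdV | by rewrite dim_AdV | exact: generates_AdV].
Qed.

End StableLine.

(** * The isomorphism types of the two subalgebras *)

Section Isomorphisms.
Variable R : realType.
Implicit Types (x y : su21 R).

Definition mx_of (n : nat) (s : seq (seq R)) : 'M[R]_n :=
  \matrix_(i, j) nth 0 (nth [::] s i) j.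

Definition rot2 (t : R) : 'M[R]_2 := mx_of 2 [:: [:: 0; - t]; [:: t; 0]].

Definition cross_mx (a b c : R) : 'M[R]_3 :=
  mx_of 3 [:: [:: 0; - c; b]; [:: c; 0; - a]; [:: - b; a; 0]].

(** The traceless part of the upper left block is a quaternion with imaginary
   coordinates (l1 + l6 / 2, l2, l3).  Commutators of imaginary quaternions are
   twice the cross product up to sign, hence the factor -2.  The lower right
   entry gives the rotation. *)
Definition h1_to_so x : 'M[R]_3 * 'M[R]_2 :=
  (cross_mx (- (2 * lam x 1 + lam x 6)) (- (2 * lam x 2)) (- (2 * lam x 3)),
   rot2 (lam x 6)).

(** The traceless part of the lower right block is in su(1,1).  It is sent to
   sl_2(R) by diag(i, -i) |-> [0, -1; 1, 0], e_7 |-> diag(1, -1) and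
   e_8 |-> [0, 1; 1, 0].  The upper left entry gives the rotation. *)
Definition h4_to_sl x : 'M[R]_2 * 'M[R]_2 :=
  (mx_of 2 [:: [:: lam x 7; lam x 8 - (lam x 6 + lam x 1 / 2)];
               [:: lam x 8 + (lam x 6 + lam x 1 / 2); - lam x 7]],
   rot2 (lam x 1)).

Lemma h1_to_so_linear : linear h1_to_so.
Proof.
by move=> a x y; congr pair; apply/matrixP;
  [case=> -[|[|[|//]]] ? -[[|[|[|//]]] ?] | case=> -[|[|//]] ? -[[|[|//]] ?]];
  rewrite !mxE /=; do ?[rewrite !lam_linear]; ring.
Qed.

Lemma h4_to_sl_linear : linear h4_to_sl.
Proof.
by move=> a x y; congr pair; apply/matrixP;
  case=> -[|[|//]] ? -[[|[|//]] ?]; rewrite !mxE /=; do ?[rewrite !lam_linear]; ring.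
Qed.

HB.instance Definition _ :=
  GRing.isLinear.Build R (su21 R) ('M[R]_3 * 'M[R]_2)%type *:%R
    h1_to_so h1_to_so_linear.
HB.instance Definition _ :=
  GRing.isLinear.Build R (su21 R) ('M[R]_2 * 'M[R]_2)%type *:%R
    h4_to_sl h4_to_sl_linear.

Lemma rot2_comm s t : rot2 s *m rot2 t = rot2 t *m rot2 s.
Proof.
apply/matrixP; case=> -[|[|//]] ? -[[|[|//]] ?];
  rewrite !mxE !big_ord_recl !big_ord0 !mxE /=; ring.
Qed.

Lemma so2P (A : 'M[R]_2) : A \in so_alg R 2 -> A = rot2 (A 1 0).
Proof.
rewrite mem_so => /eqP/matrixP e; have E i j : A j i = - A i j.
  by have := e i j; rewrite !mxE.
have [f Ef] : exists f : nat -> nat -> R, forall i j, A i j = f i j.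
  by exists (fun m n => A (inord m) (inord n)) => i j; rewrite !inord_val.
have := (E 0 0, E 1 1, E 0 1); rewrite !Ef /= => -[[e0 e1] e2].
by apply/matrixP; case=> -[|[|//]] ? -[[|[|//]] ?]; rewrite mxE !Ef /=; lra.
Qed.

Lemma rot2_so t : rot2 t \in so_alg R 2.
Proof.
rewrite mem_so; apply/eqP/matrixP; case=> -[|[|//]] ? -[[|[|//]] ?];
  by rewrite !mxE /= ?opprK ?oppr0.
Qed.

Lemma so3P (A : 'M[R]_3) : A \in so_alg R 3 ->
  A = cross_mx (A 2%R 1) (A 0 2%R) (A 1 0).
Proof.
rewrite mem_so => /eqP/matrixP e; have E i j : A j i = - A i j.
  by have := e i j; rewrite !mxE.
have [f Ef] : exists f : nat -> nat -> R, forall i j, A i j = f i j.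
  by exists (fun m n => A (inord m) (inord n)) => i j; rewrite !inord_val.
have := (E 0 0, E 1 1, E 2%R 2%R, E 0 1, E 0 2%R, E 1 2%R).
rewrite !Ef /= => -[[[[[e0 e1] e2] e3] e4] e5].
apply/matrixP; case=> -[|[|[|//]]] ? -[[|[|[|//]]] ?]; rewrite mxE !Ef /=; lra.
Qed.

Lemma cross_mx_so a b c : cross_mx a b c \in so_alg R 3.
Proof.
rewrite mem_so; apply/eqP/matrixP.
by case=> -[|[|[|//]]] ? -[[|[|[|//]]] ?]; rewrite !mxE /= ?opprK ?oppr0.
Qed.

Lemma sl2P (A : 'M[R]_2) : A \in sl_alg R 2 ->
  A = mx_of 2 [:: [:: A 0 0; A 0 1]; [:: A 1 0; - A 0 0]].
Proof.
rewrite mem_sl /mxtrace !big_ord_recl big_ord0 addr0.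
have [f Ef] : exists f : nat -> nat -> R, forall i j, A i j = f i j.
  by exists (fun m n => A (inord m) (inord n)) => i j; rewrite !inord_val.
rewrite !Ef /= => /eqP e.
apply/matrixP; case=> -[|[|//]] ? -[[|[|//]] ?]; rewrite mxE !Ef /=; lra.
Qed.

Lemma h1_to_so_lie : {in h1 R &, {morph h1_to_so : x y / lie x y}}.
Proof.
move=> x y; rewrite !mem_h1 => /and4P[/eqP x4 /eqP x5 /eqP x7 /eqP x8].
move=> /and4P[/eqP y4 /eqP y5 /eqP y7 /eqP y8].
rewrite /h1_to_so !lam_lie // /lie_coords /plucker /= x4 x5 x7 x8 y4 y5 y7 y8.
apply: (congr2 pair).
  change (lie (_, _).1 (_, _).1) with (commmx (h1_to_so x).1 (h1_to_so y).1).
  apply/matrixP; case=> -[|[|[|//]]] ? -[[|[|[|//]]] ?];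
  rewrite !mxE !big_ord_recl !big_ord0 !mxE /=; ring.
change (lie (_, _).2 (_, _).2) with (commmx (h1_to_so x).2 (h1_to_so y).2).
rewrite /commmx rot2_comm subrr.
by apply/matrixP; case=> -[|[|//]] ? -[[|[|//]] ?]; rewrite !mxE /=; ring.
Qed.

Lemma h4_to_sl_lie : {in h4 R &, {morph h4_to_sl : x y / lie x y}}.
Proof.
move=> x y; rewrite !mem_h4 => /and4P[/eqP x2 /eqP x3 /eqP x4 /eqP x5].
move=> /and4P[/eqP y2 /eqP y3 /eqP y4 /eqP y5].
rewrite /h4_to_sl !lam_lie // /lie_coords /plucker /= x2 x3 x4 x5 y2 y3 y4 y5.
apply: (congr2 pair).
  change (lie (_, _).1 (_, _).1) with (commmx (h4_to_sl x).1 (h4_to_sl y).1).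
  apply/matrixP; case=> -[|[|//]] ? -[[|[|//]] ?];
  rewrite !mxE !big_ord_recl !big_ord0 !mxE /=; by field.
change (lie (_, _).2 (_, _).2) with (commmx (h4_to_sl x).2 (h4_to_sl y).2).
rewrite /commmx rot2_comm subrr.
by apply/matrixP; case=> -[|[|//]] ? -[[|[|//]] ?]; rewrite !mxE /=; ring.
Qed.

Definition of_coords (s : seq R) : su21 R := \row_(k < 8) s`_k.

Lemma lam_of_coords s j : (0 < j < 9)%N -> lam (of_coords s) j = s`_j.-1.
Proof. by case: j => // j /andP[_ j8]; rewrite /lam mxE inordK. Qed.

Lemma h1_isom : lie_isom (h1 R) (dsumv (so_alg R 3) (so_alg R 2)).
Proof.
exists (linfun h1_to_so); split.
- apply/eqP; rewrite eqEsubv; apply/andP; split; apply/subvP.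
    by move=> _ /memv_imgP[x _ ->]; rewrite lfunE mem_dsumv rot2_so cross_mx_so.
  case=> [A B]; rewrite mem_dsumv /= => /andP[/so3P AE /so2P BE].
  pose x := of_coords [:: - (A 2%R 1 + B 1 0) / 2; - A 0 2%R / 2; - A 1 0 / 2;
    0; 0; B 1 0; 0; 0].
  have -> : (A, B) = linfun h1_to_so x.
    rewrite lfunE /= /h1_to_so !lam_of_coords //= {1}AE {1}BE.
    by congr (cross_mx _ _ _, _); field.
  by apply: memv_img; rewrite mem_h1 !lam_of_coords //= eqxx.
- move=> x y; rewrite !mem_h1 => /and4P[/eqP x4 /eqP x5 /eqP x7 /eqP x8].
  move=> /and4P[/eqP y4 /eqP y5 /eqP y7 /eqP y8]; rewrite !lfunE /= => -[].
  move=> /matrixP e /matrixP e'.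
  have := (e 2%R 1, e 0 2%R, e 1 0, e' 1 0); rewrite !mxE /= => -[[[? ?] ?] ?].
  by apply: lamP => -[|[|[|[|[|[|[|[|[|?]]]]]]]]] //= _; lra.
by move=> x y xh yh; rewrite !lfunE; apply: h1_to_so_lie.
Qed.

Lemma h4_isom : lie_isom (h4 R) (dsumv (sl_alg R 2) (so_alg R 2)).
Proof.
exists (linfun h4_to_sl); split.
- apply/eqP; rewrite eqEsubv; apply/andP; split; apply/subvP.
    move=> _ /memv_imgP[x _ ->]; rewrite lfunE mem_dsumv rot2_so andbT.
    by rewrite mem_sl /mxtrace !big_ord_recl big_ord0 !mxE /= addr0 addrN.
  case=> [A B]; rewrite mem_dsumv /= => /andP[/sl2P AE /so2P BE].
  pose x := of_coords [:: B 1 0; 0; 0; 0; 0; (A 1 0 - A 0 1 - B 1 0) / 2;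
    A 0 0; (A 1 0 + A 0 1) / 2].
  have -> : (A, B) = linfun h4_to_sl x.
    rewrite lfunE /= /h4_to_sl !lam_of_coords //= {1}AE {1}BE.
    by congr (mx_of 2 [:: [:: _; _]; [:: _; _]], _); field.
  by apply: memv_img; rewrite mem_h4 !lam_of_coords //= eqxx.
- move=> x y; rewrite !mem_h4 => /and4P[/eqP x2 /eqP x3 /eqP x4 /eqP x5].
  move=> /and4P[/eqP y2 /eqP y3 /eqP y4 /eqP y5]; rewrite !lfunE /= => -[].
  move=> /matrixP e /matrixP e'.
  have := (e 0 0, e 0 1, e 1 0, e' 1 0); rewrite !mxE /= => -[[[? ?] ?] ?].
  by apply: lamP => -[|[|[|[|[|[|[|[|[|?]]]]]]]]] //= _; lra.
by move=> x y xh yh; rewrite !lfunE; apply: h4_to_sl_lie.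
Qed.

End Isomorphisms.

(** * The classification *)

Theorem proposition9 (R : realType) :
  (forall h m : {vspace su21 R},
     [/\ reductive_with h m, \dim h = 4%N & generates_lie m] <->
     exists g : 'M[R[i]]_3, is_SU21 g /\
       ((AdV g h = h1 R /\ AdV g m = m1 R) \/
        (AdV g h = h4 R /\ AdV g m = m4 R))) /\
  lie_isom (h1 R) (dsumv (so_alg R 3) (so_alg R 2)) /\
  lie_isom (h4 R) (dsumv (sl_alg R 2) (so_alg R 2)).
Proof.
split; last by split; [exact: h1_isom | exact: h4_isom].
move=> h m; split=> [[red dh _]|[g [gP [[eh em]|[eh em]]]]].
- exact: classification red dh.
- exact: conjugate_pair gP eh em (reductive_h1 R) (dim_h1 R) (@generates_m1 R).
- exact: conjugate_pair gP eh em (reductive_h4 R) (dim_h4 R) (@generates_m4 R).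
Qed.
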